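(* Let $0<a<1$ and let $\varphi_a(z)=az+1-a$ for $z\in\mathbb{D}$. Then the composition operator $C_{\varphi_a}f=f\circ\varphi_a$ is Li--Yorke chaotic on $H^2$ and on $A^2_\beta$ for $-1<\beta<\infty$.
   Context: $\mathbb{D}$ is the open unit disk in $\mathbb{C}$ and $\mathbb{T}$ the unit circle. $H^2$ is the Hardy space of analytic $f$ on $\mathbb{D}$ with $\|f\|_2^2=\sup_{0<r<1}\int_{\mathbb{T}}|f(rz)|^2\,dm(z)<\infty$, with $m$ normalized Lebesgue measure on $\mathbb{T}$. For $-1<\beta<\infty$, $A^2_\beta$ is the weighted Bergman space of analytic $f$ on $\mathbb{D}$ with $\int_{\mathbb{D}}|f(z)|^2\,dA_\beta(z)<\infty$ (the square of the norm), where $dA_\beta(z)=(\beta+1)(1-|z|^2)^\beta\,dA(z)$ and $dA$ is normalized area measure on $\mathbb{D}$. A bounded operator $T$ on a Banach space $X$ is Li--Yorke chaotic if there is an uncountable set $S\subset X$ such that for all distinct $x,y\in S$, $\liminf_{n\to\infty}\|T^nx-T^ny\|=0$ and $\limsup_{n\to\infty}\|T^nx-T^ny\|>0$. *)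

(* Defs.v *)
From HB Require Import structures.
From mathcomp Require Import all_boot all_order all_algebra complex.
From mathcomp Require Import all_classical all_reals all_analysis.

Set Implicit Arguments.
Unset Strict Implicit.
Unset Printing Implicit Defensive.

Import Order.TTheory GRing.Theory Num.Theory numFieldNormedType.Exports.
Import ComplexField.Normc.

Local Open Scope classical_set_scope.
Local Open Scope complex_scope.
Local Open Scope ring_scope.

(* [R[i]] packed as a [numFieldType]: this is what gives it the topology and
   the module structure over itself that MathComp-Analysis attaches to an
   abstract [numFieldType]. *)
Definition Cplx (R : realType) : numFieldType := R[i].

Section LiYorke.
Variables (R : realType) (K : numFieldType) (V : lmodType K).

(* The normed space is given by its carrier [X] in the ambient space [V] and
   its norm [N], which is only meaningful on [X]; [T] acts on [V] and only its
   restriction to [X] matters. *)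
Implicit Types (X : set V) (N : V -> R) (T : V -> V).

Definition bounded_operator X N T : Prop :=
  [/\ forall x, X x -> X (T x),
      forall (k : K) x y, X x -> X y -> T (k *: x + y) = k *: T x + T y
    & exists M : R, forall x, X x -> N (T x) <= M * N x].

(* Limits inferior and superior are taken in [\bar R], since the orbits may be
   unbounded. *)
Definition li_yorke_chaotic X N T : Prop :=
  bounded_operator X N T /\
  exists S : set V,
    [/\ S `<=` X, ~ countable S &
      forall x y, S x -> S y -> x <> y ->
        let d n := (N (iter n T x - iter n T y))%:E in
        limn_einf d = 0%E /\ (0 < limn_esup d)%E].

End LiYorke.

Section Disk.
Variable R : realType.
Local Notation C := (Cplx R).

Definition disk : Type := {z : C | normc z < 1}.

Definition analytic (f : disk -> C) : Prop :=
  forall z0 : disk, exists (c : nat -> C) (r : R), 0 < r /\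
    forall z : disk, normc (val z - val z0) < r ->
      series (fun n => c n * (val z - val z0) ^+ n) @ \oo --> f z.

(* Extension by zero, so that integrals can be written over subsets of the
   plane. *)
Definition ext0 (f : disk -> C) (z : C) : C := oapp f 0 (insub z).

Definition circle_mean (f : disk -> C) (r : R) : \bar R :=
  (((2 * pi)^-1)%:E * \int[lebesgue_measure]_(t in `[0%R, (2 * pi)%R])
    (normc (ext0 f ((r * cos t) +i* (r * sin t))) ^+ 2)%:E)%E.

Definition hardy_sqnorm (f : disk -> C) : \bar R :=
  ereal_sup [set circle_mean f r | r in `]0, 1[%classic].

Definition hardy_norm (f : disk -> C) : R := Num.sqrt (fine (hardy_sqnorm f)).

Definition hardy_space : set (disk -> C) :=
  [set f | analytic f /\ (hardy_sqnorm f < +oo)%E].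

(* The factor [pi^-1] normalizes the area measure. *)
Definition bergman_weight (b : R) (z : C) : R :=
  pi^-1 * (b + 1) * (1 - normc z ^+ 2) `^ b.

Definition bergman_sqnorm (b : R) (f : disk -> C) : \bar R :=
  (\int[lebesgue_measure \x lebesgue_measure]_(p in
      [set p : R * R | (normc (p.1 +i* p.2) < 1)%R])
    (normc (ext0 f (p.1 +i* p.2)) ^+ 2 * bergman_weight b (p.1 +i* p.2))%:E)%E.

Definition bergman_norm (b : R) (f : disk -> C) : R :=
  Num.sqrt (fine (bergman_sqnorm b f)).

Definition bergman_space (b : R) : set (disk -> C) :=
  [set f | analytic f /\ (bergman_sqnorm b f < +oo)%E].

Definition comp_op (phi : disk -> disk) (f : disk -> C) : disk -> C := f \o phi.

Lemma affine_disk (a : R) : 0 < a < 1 ->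
  forall z : disk, normc (a%:C * val z + (1 - a)%:C : C) < 1.
Proof.
have normcR (x : R) : 0 <= x -> normc x%:C = x.
  by move=> x0; rewrite /normc /= expr0n addr0 sqrtr_sqr ger0_norm.
move=> /andP[a0 a1] [z z1] /=; apply: le_lt_trans (le_normcD _ _) _.
have -> : normc (a%:C * z : C) = normc a%:C * normc z by exact: normcM.
rewrite !normcR ?subr_ge0 ?ltW // -ltrBrDr opprB addrCA subrr addr0.
by rewrite -[ltRHS]mulr1 ltr_pM2l.
Qed.

Definition affine_map (a : R) (ha : 0 < a < 1) (z : disk) : disk :=
  exist (fun w : C => is_true (normc w < 1)) _ (affine_disk ha z).

End Disk.

(* Main.v *)
(* Everything is expressed through Taylor coefficients.  Write
   [h_c(r) = sum_n |c_n|^2 r^(2n)] for [f = sum_n c_n z^n]: the squared Hardy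
   norm of [f] is the supremum of [h_c] on [0, 1), and, integrating in polar
   coordinates, the squared Bergman norm is
   [2 (b + 1) * int_0^1 h_c(r) (1 - r^2)^b r dr].

   Boundedness.  The coefficients of [f o phi] are the image of [c] under the
   matrix [C(n, k) a^k (1 - a)^(n - k)], whose row and column sums are
   controlled; Schur's test gives
   [h_(f o phi)(r) <= (2 / a) h_f(1 - (a / 2)(1 - r))], and the affine change
   of variable on the right is harmless for the weight.

   Chaos.  In the variable [u = 1 - z] the map [phi] is the dilation
   [u |-> a u].  Hence the operator sends the bump
   [p_s = s / (s + u) - a s / (a s + u)] to [p_(s / a)]: it shifts the sequence
   [p_(a^k)], whose Hardy norms decay geometrically as [k] goes to infinity or
   minus infinity.  Let [f] be the sum of [p_(a^k)] over the squares [k].  Far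
   from the squares the orbit of [f] is small, while at the times [n = j^2] its
   value at the origin is at least [p_1(0) > 0].  The multiples of [f] by real
   numbers form the required uncountable set. *)

Require Import Defs.
From HB Require Import structures.
From mathcomp Require Import all_boot all_order all_algebra complex.
From mathcomp Require Import all_classical all_reals all_analysis.
From mathcomp Require Import measurable_realfun.
From mathcomp Require Import ring lra.
Import Order.TTheory GRing.Theory Num.Theory numFieldNormedType.Exports.
Import ComplexField.Normc.
Set Implicit Arguments.
Unset Strict Implicit.
Unset Printing Implicit Defensive.
Local Open Scope classical_set_scope.
Local Open Scope complex_scope.
Local Open Scope ring_scope.

(** [analytic] only provides a power series near each point, whereas every norm estimate needs one
    expansion valid on the whole disk. Contour integration is replaced by Parseval, which bounds
    coefficients by the size of the function on a circle; with compactness of circles this lets the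
    radius of the expansion at 0 grow to 1.

    Both spaces are treated by one criterion. It asks of the squared norm only that it lie between
    multiples of [normc (c 0%N) ^+ 2] and [hmean c 1], be homogeneous under real scalars, and grow
    by at most a constant factor under composition. Smallness is thus proved once, through
    [hmean c 1], and largeness is read at the origin.

    The bump is a difference of poles because [s / (s + u)] alone tends to the constant 1 as [s]
    grows, and constants are fixed by the operator. Squares are used because their gaps grow: the
    times [j * j.+1] are ever farther from all of them. Two real multiples of [f] have orbits that
    differ by a multiple of the orbit of [f], so a single vector is enough. *)

Local Notation re := (@complex.Re _).
Local Notation im := (@complex.Im _).

(** * Series of complex numbers *)

Section Modulus.
Variable R : realType.
Local Notation C := (Cplx R).
Implicit Types (x y z w l : C) (u v : nat -> C).

Lemma normc_ge0 z : 0 <= normc z.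
Proof. by case: z => p q; exact: sqrtr_ge0. Qed.

Lemma normc_eq0 z : (normc z == 0) = (z == 0).
Proof. by apply/eqP/eqP => [/eq0_normc //|->]; exact: normc0. Qed.

Lemma modM x y : normc (x * y) = normc x * normc y.
Proof. exact: normcM. Qed.

Lemma modD x y : normc (x + y) <= normc x + normc y.
Proof. exact: le_normcD. Qed.

Lemma modN x : normc (- x) = normc x.
Proof. exact: normcN. Qed.

Lemma modB x y : normc (x - y) <= normc x + normc y.
Proof. by rewrite -(modN y) modD. Qed.

Lemma mod_distC x y : normc (x - y) = normc (y - x).
Proof. by rewrite -modN opprB. Qed.

Lemma mod_le_sub x y : normc x <= normc (x - y) + normc y.
Proof. by rewrite -{1}(subrK y x) modD. Qed.

Lemma mod0 : normc (0 : C) = 0.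
Proof. exact: normc0. Qed.

Lemma modX x n : normc (x ^+ n) = normc x ^+ n.
Proof.
elim: n => [|n IH]; first by rewrite !expr0; exact: normc1.
by rewrite !exprS modM IH.
Qed.

Lemma mod_real (r : R) : normc (r%:C : C) = `|r|.
Proof. by rewrite /normc /= expr0n addr0 sqrtr_sqr. Qed.

Lemma modMn x n : normc (x *+ n) = normc x *+ n.
Proof. exact: normcMn. Qed.

Lemma mod_sum n u : normc (\sum_(k < n) u k) <= \sum_(k < n) normc (u k).
Proof.
elim: n => [|n IH]; first by rewrite !big_ord0 mod0.
by rewrite !big_ord_recr /=; apply: (le_trans (modD _ _)); rewrite lerD2r.
Qed.

Lemma sqr_mod z : normc z ^+ 2 = complex.Re z ^+ 2 + complex.Im z ^+ 2.
Proof. by case: z => p q /=; rewrite sqr_sqrtr // addr_ge0 ?sqr_ge0. Qed.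

Lemma Re_le_mod z : `|complex.Re z| <= normc z.
Proof.
by rewrite -(ler_pXn2r (n := 2)) ?nnegrE ?normc_ge0 // sqr_mod real_normK ?num_real //
  lerDl sqr_ge0.
Qed.

Lemma Im_le_mod z : `|complex.Im z| <= normc z.
Proof.
by rewrite -(ler_pXn2r (n := 2)) ?nnegrE ?normc_ge0 // sqr_mod real_normK ?num_real //
  lerDr sqr_ge0.
Qed.

Lemma mod_le_ReIm z : normc z <= `|complex.Re z| + `|complex.Im z|.
Proof.
rewrite -(ler_pXn2r (n := 2)) ?nnegrE ?normc_ge0 ?addr_ge0 //.
rewrite sqr_mod sqrrD !real_normK ?num_real // lerD2r lerDl mulrn_wge0 //.
Qed.

Lemma Re_sum n u : complex.Re (\sum_(k < n) u k) = \sum_(k < n) complex.Re (u k).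
Proof.
elim: n => [|n IH]; first by rewrite !big_ord0.
by rewrite !big_ord_recr /= -IH; case: (\sum_(k < n) u k) => ??; case: (u n).
Qed.

Lemma Im_sum n u : complex.Im (\sum_(k < n) u k) = \sum_(k < n) complex.Im (u k).
Proof.
elim: n => [|n IH]; first by rewrite !big_ord0.
by rewrite !big_ord_recr /= -IH; case: (\sum_(k < n) u k) => ??; case: (u n).
Qed.

(** Convergence is measured by the real-valued modulus, which keeps all estimates in [R]; the norm
    of [C] as a [numFieldType] takes values in [C] itself. [has_csumE] is the bridge to the
    topological form used in [analytic]. *)
Definition has_csum u l := forall e : R, 0 < e ->
  exists N, forall n, (N <= n)%N -> normc (l - \sum_(k < n) u k) < e.

Lemma has_csumE u l : has_csum u l <-> series u @ \oo --> l.
Proof.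
have nE z : `|z| = (normc z)%:C :> C by [].
split=> [h|/cvgrPdist_lt h e e0].
  apply/cvgrPdist_lt => e e0.
  (* In the partial order of [C], [0 < e] forces the imaginary part of [e] to vanish. *)
  have eR : e = (complex.Re e)%:C.
    by case: e e0 => p q; rewrite ltcE /= => /andP[/eqP ->].
  have /h [N hN] : 0 < complex.Re e by rewrite eR in e0; rewrite ltcR in e0.
  exists N => // n /= /hN; rewrite nE /series /= big_mkord => ?.
  by rewrite eR ltcR.
have : 0 < (e%:C : C) by rewrite ltcR.
move=> /h [N _ hN]; exists N => n /hN; rewrite nE /series /= big_mkord.
by rewrite ltcR.
Qed.

Lemma has_csum_eq u v l : (forall n, u n = v n) -> has_csum u l -> has_csum v l.
Proof. by move=> /funext ->. Qed.

Lemma has_csum_le u l w (M : R) N :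
  has_csum u l -> (forall n, (N <= n)%N -> normc (\sum_(k < n) u k - w) <= M) ->
  normc (l - w) <= M.
Proof.
move=> h hM; apply/ler_addgt0Pr => e /h[N' hN].
have := hN (maxn N N') (leq_maxr _ _); have := hM (maxn N N') (leq_maxl _ _).
set s := \sum_(k < _) _ => h1 h2.
rewrite -(subrK s l) -addrA; apply: le_trans (modD _ _) _.
by rewrite [M + e]addrC lerD // ltW.
Qed.

Lemma has_csum_le0 u l (M : R) :
  has_csum u l -> (forall n, normc (\sum_(k < n) u k) <= M) -> normc l <= M.
Proof.
move=> h hM; rewrite -[l]subr0; apply: (has_csum_le (N := 0) h) => n _.
by rewrite subr0.
Qed.

Lemma has_csum_unique u l w : has_csum u l -> has_csum u w -> l = w.
Proof.
move=> h h'; apply/eqP; rewrite -subr_eq0 -normc_eq0 eq_le normc_ge0 andbT.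
apply/ler_addgt0Pr => e e0; rewrite add0r.
have [N hN] := h' _ e0; apply: (has_csum_le (N := N) h) => n /hN/ltW.
by rewrite mod_distC.
Qed.

Lemma has_csumD u v l w : has_csum u l -> has_csum v w ->
  has_csum (fun n => u n + v n) (l + w).
Proof.
move=> hu hv e e0; have e2 : 0 < e / 2 by rewrite divr_gt0.
have [N1 h1] := hu _ e2; have [N2 h2] := hv _ e2.
exists (maxn N1 N2) => n; rewrite geq_max => /andP[/h1 n1 /h2 n2].
rewrite big_split /= opprD addrACA; apply: le_lt_trans (modD _ _) _.
by rewrite (splitr e) ltrD.
Qed.

Lemma has_csumZ u l x : has_csum u l -> has_csum (fun n => x * u n) (x * l).
Proof.
move=> hu e e0; have x1 : 0 < normc x + 1 by rewrite ltr_wpDl ?normc_ge0.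
have [N h] := hu (e / (normc x + 1)) (divr_gt0 e0 x1).
exists N => n /h; rewrite -mulr_sumr -mulrBr modM ltr_pdivlMr // mulrC => hh.
by apply: le_lt_trans hh; rewrite ler_wpM2r ?normc_ge0 // lerDl.
Qed.

Lemma has_csum_fin u N : (forall n, (N <= n)%N -> u n = 0) ->
  has_csum u (\sum_(k < N) u k).
Proof.
move=> h e e0; exists N => n Nn.
have -> : \sum_(k < n) u k = \sum_(k < N) u k.
  rewrite -(subnKC Nn) big_split_ord /= [X in _ + X]big1 ?addr0 //.
  by move=> i _; rewrite h // leq_addr.
by rewrite subrr mod0.
Qed.

Definition abs_bdd u (M : R) := forall n, \sum_(k < n) normc (u k) <= M.

Lemma abs_bdd_ge0 u M : abs_bdd u M -> 0 <= M.
Proof. by move=> /(_ 0%N); rewrite big_ord0. Qed.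

Lemma nonneg_series_cvg (v : nat -> R) M : (forall n, 0 <= v n) ->
  (forall n, \sum_(k < n) v k <= M) -> cvgn (series v).
Proof.
move=> v0 hM; apply: nondecreasing_is_cvgn.
  by apply/nondecreasing_seqP => n; rewrite /series /= big_nat_recr //= lerDl.
by exists M => _ [n _ <-]; rewrite /series /= big_mkord.
Qed.

Lemma abs_bdd_csum u M : abs_bdd u M -> exists l, has_csum u l.
Proof.
move=> hM.
have cv (f : C -> R) : (forall z, `|f z| <= normc z) ->
    cvgn (series (fun n => f (u n))).
  move=> hf; apply: normed_cvg; apply: (@nonneg_series_cvg _ M) => n; first exact:
    normr_ge0.
    by apply: le_trans (hM n); apply: ler_sum => i _; exact: hf.
have /cvg_ex[/= p hp] := cv _ Re_le_mod; have /cvg_ex[/= q hq] := cv _ Im_le_mod.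
exists (p +i* q) => e e0; have e2 : 0 < e / 2 by rewrite divr_gt0.
move/cvgrPdist_lt: hp => /(_ _ e2)[N1 _ h1].
move/cvgrPdist_lt: hq => /(_ _ e2)[N2 _ h2].
exists (maxn N1 N2) => n; rewrite geq_max => /andP[/h1 /= n1 /h2 /= n2].
apply: le_lt_trans (mod_le_ReIm _) _; rewrite (splitr e).
rewrite /series /= !big_mkord -Re_sum -Im_sum in n1 n2.
by case: (\sum_(k < n) u k) n1 n2 => ?? /= n1 n2; rewrite ltrD.
Qed.

Lemma abs_bdd_le u M l : abs_bdd u M -> has_csum u l -> normc l <= M.
Proof.
move=> hM h; apply: has_csum_le0 h _ => n.
by apply: le_trans (hM n); exact: mod_sum.
Qed.

Lemma has_csum_bounded u l : has_csum u l -> exists B : R, forall n, normc (u n) <= B.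
Proof.
move=> h; have [N hN] := h 1 ltr01.
exists (\sum_(k < N) normc (u k) + 2) => n; case: (leqP N n) => [Nn|nN].
  have -> : u n = (l - \sum_(k < n) u k) - (l - \sum_(k < n.+1) u k).
    by rewrite big_ord_recr /=; set s := \sum_(k < n) u k; ring.
  apply: le_trans (modB _ _) _; apply: ler_wpDl.
    by rewrite sumr_ge0 // => i _; exact: normc_ge0.
  by rewrite (_ : 2 = 1 + 1) //; rewrite lerD // ltW // hN // leqW.
rewrite (bigD1 (Ordinal nN)) //= -addrA lerDl addr_ge0 //.
by rewrite sumr_ge0 // => i _; exact: normc_ge0.
Qed.

(* Finite rectangles of absolute sums nearly exhausting the supremum [S]
   control all the remaining partial sums at once. *)
Lemma has_csum_exchange (u : nat -> nat -> C) (M : R) (r s : nat -> C) t :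
  (forall m n, \sum_(i < m) \sum_(j < n) normc (u i j) <= M) ->
  (forall i, has_csum (u i) (r i)) -> (forall j, has_csum (u^~ j) (s j)) ->
  has_csum r t -> has_csum s t.
Proof.
move=> hM hr hs ht.
pose A m n := \sum_(i < m) \sum_(j < n) normc (u i j).
pose P m n := \sum_(i < m) \sum_(j < n) u i j.
have Amono m n m' n' : (m <= m')%N -> (n <= n')%N ->
    normc (P m' n' - P m n) <= A m' n' - A m n.
  move=> /subnKC <- /subnKC <-; move: (m' - m)%N (n' - n)%N => p q.
  rewrite /P /A !big_split_ord /= !(addrAC _ _ (- _)) -!sumrB.
  apply: le_trans (modD _ _) _; rewrite lerD //.
    apply: le_trans (mod_sum _ (fun i => \sum_(j < n + q) u i j - \sum_(j < n) u i j)) _.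
    apply: ler_sum => i _; rewrite !big_split_ord /= !(addrAC _ _ (- _)) !subrr !add0r.
    exact: (mod_sum q (fun j => u i (n + j)%N)).
  apply: le_trans (mod_sum p (fun i => \sum_(j < n + q) u (m + i)%N j)) _.
  by apply: ler_sum => i _; exact: (mod_sum (n + q) (fun j => u (m + i)%N j)).
pose E := [set A mn.1 mn.2 | mn in [set: nat * nat]].
have supE : has_sup E.
  by split; [exists (A 0%N 0%N); exists (0%N, 0%N) | exists M => _ [mn _ <-]; exact: hM].
have near e : 0 < e -> exists m n, forall m' n', (m <= m')%N -> (n <= n')%N ->
    normc (P m' n' - P m n) <= e.
  move=> e0; have [_ [[m n] _ <-] /= hmn] := sup_adherent e0 supE.
  exists m, n => m' n' mm nn; apply: le_trans (Amono _ _ _ _ mm nn) _.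
  rewrite lerBlDr; have : A m' n' <= sup E.
    by apply: sup_upper_bound => //; exists (m', n').
  move=> /le_trans; apply; lra.
have lim_in (v : nat -> nat -> C) (rv : nat -> C) m : (forall i, has_csum (v i) (rv i)) ->
    has_csum (fun j => \sum_(i < m) v i j) (\sum_(i < m) rv i).
  move=> h; elim: m => [|m IH].
    rewrite big_ord0; apply: (has_csum_eq (u := fun=> 0)).
      by move=> n; rewrite big_ord0.
    have := @has_csum_fin (fun=> 0) 0 (fun n _ => erefl); by rewrite big_ord0.
  rewrite big_ord_recr /=; apply: (has_csum_eq _ (has_csumD IH (h m))) => n.
  by rewrite big_ord_recr.
move=> e e0; have e3 : 0 < e / 3 by rewrite divr_gt0.
have [m [n hmn]] := near _ e3; exists n => n' nn'.
have h1 : normc (\sum_(j < n') s j - P m n) <= e / 3.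
  apply: (has_csum_le (N := m) (lim_in (fun j i => u i j) s n' hs)) => m' mm'.
  by have := hmn m' n' mm' nn'; rewrite {1}/P exchange_big.
have h2 : normc (t - P m n) <= e / 3.
  apply: (has_csum_le (N := m) ht) => m' mm'.
  apply: (has_csum_le (N := n) (lim_in u r m' hr)) => n'' nn''.
  by have := hmn m' n'' mm' nn''; rewrite {1}/P exchange_big.
rewrite -(subrK (P m n) t) -addrA; apply: le_lt_trans (modD _ _) _.
by rewrite [X in _ + X]mod_distC; apply: le_lt_trans (lerD h2 h1) _; lra.
Qed.

End Modulus.

(** * Parseval's identity *)

Section Parseval.
Variable R : realType.
Local Notation C := (Cplx R).
Local Notation mu := (@lebesgue_measure R).
Implicit Types (b c : nat -> C) (t : R).

Definition cis t : C := cos t +i* sin t.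

Lemma cisD s t : cis (s + t) = cis s * cis t.
Proof. by rewrite /cis cosD sinD; apply/eqP; rewrite eq_complex /= eqxx addrC eqxx. Qed.

Lemma cisX t n : cis t ^+ n = cis (n%:R * t).
Proof.
elim: n => [|n IH]; first by rewrite mul0r /cis cos0 sin0.
by rewrite exprS IH -cisD -natr1 mulrDl mul1r addrC.
Qed.

Lemma mod_cis t : normc (cis t) = 1.
Proof. by rewrite /normc /cis /= cos2Dsin2 sqrtr1. Qed.

(** The mean over a period is witnessed by an antiderivative, so means of trigonometric polynomials
    are computed by algebra alone. Integrals enter once, through the fundamental theorem of calculus
    in [integral_has_mean]. *)
Definition has_mean (h : R -> R) (m : R) := continuous h /\
  exists F : R -> R, (forall t, is_derive t (1 : R) F (h t)) /\ F (2 * pi) - F 0 = 2 *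
    pi * m.

Lemma has_meanD h1 h2 m1 m2 : has_mean h1 m1 -> has_mean h2 m2 ->
  has_mean (fun t => h1 t + h2 t) (m1 + m2).
Proof.
move=> [c1 [F1 [d1 e1]]] [c2 [F2 [d2 e2]]]; split.
  by move=> t; apply: cvgD; [exact: c1|exact: c2].
exists (F1 + F2); split=> [t|]; last by rewrite !fctE [RHS]mulrDr -e1 -e2; ring.
exact: is_deriveD.
Qed.

Lemma has_meanZ h m k : has_mean h m -> has_mean (fun t => k * h t) (k * m).
Proof.
move=> [c1 [F1 [d1 e1]]]; split.
  by move=> t; apply: cvgM; [exact: cvg_cst|exact: c1].
exists (k *: F1); split=> [t|]; last first.
  by change (k * F1 (2 * pi) - k * F1 0 = 2 * pi * (k * m)); rewrite -mulrBr e1; ring.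
exact: is_deriveZ.
Qed.

Lemma is_derive_scale (k t : R) : is_derive t 1 ( *%R k) k.
Proof.
have := @is_deriveZ R R R id k t 1 1 (is_derive_id t 1).
by rewrite /GRing.scale /= mulr1.
Qed.

Lemma has_mean_cst k : has_mean (fun=> k) k.
Proof.
split; first by move=> t; exact: cvg_cst.
exists ( *%R k); split=> [t|]; last first.
  by change (k * (2 * pi) - k * 0 = 2 * pi * k); ring.
exact: is_derive_scale.
Qed.

Lemma cos_turns n : cos (n%:R * (2 * pi)) = 1 :> R.
Proof.
have := periodicn (@cosD2pi R) n 0; rewrite add0r cos0 => e; rewrite -[RHS]e; congr cos.
by rewrite -[in RHS]mulrnA -[RHS]mulr_natl natrM; ring.
Qed.

Lemma sin_turns n : sin (n%:R * (2 * pi)) = 0 :> R.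
Proof.
have := periodicn (@sinD2pi R) n 0; rewrite add0r sin0 => e; rewrite -[RHS]e; congr sin.
by rewrite -[in RHS]mulrnA -[RHS]mulr_natl natrM; ring.
Qed.

Lemma has_mean_cos n : (0 < n)%N -> has_mean (fun t => cos (n%:R * t)) 0.
Proof.
move=> n0; have n1 : (n%:R : R) != 0 by rewrite pnatr_eq0 -lt0n.
split.
  move=> t; apply: continuous_comp; last exact: continuous_cos.
  by apply: cvgM; [exact: cvg_cst|exact: cvg_id].
exists (n%:R^-1 *: (sin \o ( *%R n%:R))); split=> [t|]; last first.
  change (n%:R^-1 * sin (n%:R * (2 * pi)) - n%:R^-1 * sin (n%:R * 0) = 2 * pi * 0 :> R).
  by rewrite sin_turns !mulr0 sin0 mulr0 subr0.
have -> : cos (n%:R * t) = n%:R^-1 *: (cos (n%:R * t) * n%:R) :> R.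
  by rewrite -[RHS]/(n%:R^-1 * (cos (n%:R * t) * n%:R)) [RHS]mulrC mulfK.
apply: is_deriveZ; apply: is_derive1_comp.
exact: is_derive_scale.
Qed.

Lemma has_mean_sin n : (0 < n)%N -> has_mean (fun t => sin (n%:R * t)) 0.
Proof.
move=> n0; have n1 : (n%:R : R) != 0 by rewrite pnatr_eq0 -lt0n.
split.
  move=> t; apply: continuous_comp; last exact: continuous_sin.
  by apply: cvgM; [exact: cvg_cst|exact: cvg_id].
exists ((- n%:R^-1) *: (cos \o ( *%R n%:R))); split=> [t|]; last first.
  change (- n%:R^-1 * cos (n%:R * (2 * pi)) - - n%:R^-1 * cos (n%:R * 0) = 2 * pi * 0 :>
    R).
  by rewrite cos_turns !mulr0 cos0 subrr.
have -> : sin (n%:R * t) = (- n%:R^-1) *: (- sin (n%:R * t) * n%:R) :> R.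
  by rewrite -[RHS]/(- n%:R^-1 * (- sin (n%:R * t) * n%:R)) mulNr mulNr mulrN opprK
    [RHS]mulrC mulfK.
apply: is_deriveZ; apply: is_derive1_comp.
exact: is_derive_scale.
Qed.

Lemma eq_has_mean h1 h2 m : h1 =1 h2 -> has_mean h1 m -> has_mean h2 m.
Proof. by move=> /funext ->. Qed.

Lemma has_mean_sum (h : nat -> R -> R) n : (forall k, (k < n)%N -> has_mean (h k) 0) ->
  has_mean (fun t => \sum_(k < n) h k t) 0.
Proof.
elim: n => [|n IH] hh.
  by apply: (eq_has_mean _ (has_mean_cst 0)) => t; rewrite big_ord0.
have {}IH := IH (fun k kn => hh k (leqW kn)).
have := has_meanD IH (hh n (leqnn _)); rewrite addr0; apply: eq_has_mean => t.
by rewrite big_ord_recr.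
Qed.

Definition cdot (x y : C) : R := re x * re y + im x * im y.

Lemma sqr_modD (x y : C) : normc (x + y) ^+ 2 = normc x ^+ 2 + normc y ^+ 2 + 2 * cdot x
  y.
Proof. by case: x y => [p q] [p' q']; rewrite /cdot !sqr_mod /=; ring. Qed.

(** A common rotation by [cis t ^+ n] preserves the real inner product, so only the difference [k]
    of the frequencies remains. For positive [k] both terms on the right have mean zero, which is
    the orthogonality behind Parseval. *)
Lemma cdot_cis (x y : C) n k t :
  cdot (x * cis t ^+ n) (y * cis t ^+ (n + k)) =
  cdot x y * cos (k%:R * t) + (im x * re y - re x * im y) * sin (k%:R * t).
Proof.
rewrite exprD !cisX; case: x y => [p q] [p' q']; rewrite /cdot /cis /=.
have := cos2Dsin2 (n%:R * t); move: (cos (n%:R * t)) (sin (n%:R * t)) => u v.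
move=> uv; transitivity ((u ^+ 2 + v ^+ 2) * ((p * p' + q * q') * cos (k%:R * t) +
  (q * p' - p * q') * sin (k%:R * t))); last by rewrite uv mul1r.
by ring.
Qed.

Lemma has_mean_trig b n :
  has_mean (fun t => normc (\sum_(k < n) b k * cis t ^+ k) ^+ 2)
           (\sum_(k < n) normc (b k) ^+ 2).
Proof.
elim: n => [|n IH].
  by rewrite big_ord0; apply: (eq_has_mean _ (has_mean_cst 0)) => t; rewrite big_ord0
    mod0 expr0n.
rewrite big_ord_recr /= -[X in has_mean _ X]addr0.
have h0 : has_mean (fun t => 2 * \sum_(k < n) cdot (b k * cis t ^+ k) (b n * cis t ^+
  n)) 0.
  have := @has_meanZ _ _ 2 (@has_mean_sum (fun k t => cdot (b k * cis t ^+ k) (b n * cis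
    t ^+ n)) n _).
  rewrite mulr0; apply => k kn.
  have kn0 : (0 < n - k)%N by rewrite subn_gt0.
  have := has_meanD (has_meanZ (cdot (b k) (b n)) (has_mean_cos kn0))
    (has_meanZ (im (b k) * re (b n) - re (b k) * im (b n)) (has_mean_sin kn0)).
  rewrite !mulr0 addr0; apply: eq_has_mean => t.
  by rewrite -(cdot_cis _ _ k) subnKC // ltnW.
apply: (eq_has_mean _ (has_meanD (has_meanD IH (has_mean_cst _)) h0)) => t.
rewrite big_ord_recr /= sqr_modD modM modX mod_cis expr1n mulr1; congr (_ + 2 * _).
rewrite /cdot (Re_sum n (fun k => b k * cis t ^+ k)) (Im_sum n (fun k => b k * cis t ^+
  k)) !mulr_suml -big_split /=.
by [].
Qed.

Lemma integral_has_mean h m : has_mean h m ->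
  (\int[mu]_(t in `[0%R, (2 * pi)%R]) (h t)%:E = (2 * pi * m)%:E)%E.
Proof.
move=> [ch [F [dF eF]]].
have cF : continuous F.
  by move=> t; apply: differentiable_continuous; apply/derivable1_diffP; have [] := dF t.
rewrite (@continuous_FTC2 _ h F) -?EFinB ?eF //.
- by rewrite mulr_gt0 // pi_gt0.
- by apply: continuous_subspaceT.
- split; [by move=> t _; have [] := dF t| |].
    by apply: cvg_at_right_filter; exact: cF.
  by apply: cvg_at_left_filter; exact: cF.
- by move=> t _; rewrite derive1E; have [_] := dF t.
Qed.

End Parseval.

Section ParsevalSeries.
Variable R : realType.
Local Notation C := (Cplx R).
Local Notation mu := (@lebesgue_measure R).
Implicit Types (b c : nat -> C) (t : R).

Lemma has_csum_cvg_mod (u : nat -> C) l : has_csum u l ->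
  (fun n => normc (\sum_(k < n) u k)) @ \oo --> normc l.
Proof.
move=> h; apply/cvgrPdist_lt => e /h [N hN]; exists N => // n /= /hN; apply: le_lt_trans.
rewrite ler_distlC lerBlDr addrC -lerBlDr.
by rewrite lerBlDl addrC mod_le_sub -lerBlDr lerBlDl addrC mod_distC addrC mod_le_sub.
Qed.

Lemma cvg_sqr (u : nat -> R) (l : R) : u @ \oo --> l -> (fun n => u n ^+ 2) @ \oo --> l
  ^+ 2.
Proof.
have -> : (fun n => u n ^+ 2) = u \* u by apply/funext => n; rewrite expr2.
by move=> h; rewrite expr2; exact: cvgM.
Qed.

Lemma cvg_EFin_seq (u : nat -> R) (l : R) : u @ \oo --> l ->
  (fun n => (u n)%:E) @ \oo --> l%:E.
Proof. by move=> h; apply: cvg_EFin => //; exact: nearW. Qed.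

Lemma nneseries_sqr_cvg (v : nat -> R) :
  (fun n => (\sum_(k < n) v k ^+ 2)%:E) @ \oo --> (\sum_(n <oo) (v n ^+ 2)%:E)%E.
Proof.
have -> : (fun n => (\sum_(k < n) v k ^+ 2)%:E) =
    (fun n => \sum_(0 <= k < n) (v k ^+ 2)%:E)%E.
  by apply/funext => n; rewrite sumEFin big_mkord.
by apply: is_cvg_nneseries => n _; rewrite lee_fin sqr_ge0.
Qed.

Lemma measurable_trig_series b (g : R -> C) :
  (forall t, has_csum (fun n => b n * cis t ^+ n) (g t)) ->
  measurable_fun (setT : set (measurableTypeR R)) (fun t : R => (normc (g t) ^+ 2)%:E).
Proof.
move=> hg; pose f n (t : R) : \bar R := (normc (\sum_(k < n) b k * cis t ^+ k) ^+ 2)%:E.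
apply: (emeasurable_fun_cvg f) => [n|t _].
  apply/measurable_EFinP; apply: continuous_measurable_fun.
  by have [] := has_mean_trig b n.
apply: cvg_EFin; first exact: nearW.
exact: cvg_sqr (has_csum_cvg_mod (hg t)).
Qed.

(** The partial sums are trigonometric polynomials of modulus at most [M], so dominated convergence
    with the constant [M ^+ 2] carries their exact means to the limit. *)
Lemma parseval b M (g : R -> C) : abs_bdd b M ->
  (forall t, has_csum (fun n => b n * cis t ^+ n) (g t)) ->
  (\int[mu]_(t in `[0%R, (2 * pi)%R]) (normc (g t) ^+ 2)%:E =
   (2 * pi)%:E * \sum_(n <oo) (normc (b n) ^+ 2)%:E)%E.
Proof.
move=> hM hg.
pose f n (t : R) : \bar R := (normc (\sum_(k < n) b k * cis t ^+ k) ^+ 2)%:E.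
have mf n : measurable_fun (setT : set (measurableTypeR R)) (f n).
  apply/measurable_EFinP; apply: continuous_measurable_fun.
  by have [] := has_mean_trig b n.
have cf t : f ^~ t @ \oo --> (normc (g t) ^+ 2)%:E.
  apply: cvg_EFin; first exact: nearW.
  exact: cvg_sqr (has_csum_cvg_mod (hg t)).
have int_f n : (\int[mu]_(t in `[0%R, (2 * pi)%R]) f n t =
    (2 * pi)%:E * (\sum_(k < n) normc (b k) ^+ 2)%:E)%E.
  by rewrite -EFinM; apply: integral_has_mean; exact: has_mean_trig.
have h1 : (\int[mu]_(t in `[0%R, (2 * pi)%R]) f n t)%E @[n --> \oo] -->
    ((2 * pi)%:E * \sum_(n <oo) (normc (b n) ^+ 2)%:E)%E.
  under eq_fun do rewrite int_f.
  apply: cvgeZl => //; exact: nneseries_sqr_cvg.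
have [] := @dominated_convergence _ _ _ mu `[0%R, (2 * pi)%R] _ f
   (fun t => (normc (g t) ^+ 2)%:E) (fun=> (M ^+ 2)%:E).
- by [].
- move=> n; exact: (measurable_funS measurableT (@subsetT _ _) (mf n)).
- exact: (measurable_funS measurableT (@subsetT _ _) (measurable_trig_series hg)).
- by apply: aeW => t _; exact: cf.
- apply/integrableP; split; first exact: measurable_cst.
  rewrite integral_cst //= lebesgue_measure_itv /= lte_fin mulr_gt0 ?pi_gt0 //.
  by rewrite -EFinM ltry.
- apply: aeW => t n _; rewrite /f /= lee_fin ger0_norm ?sqr_ge0 // ler_pXn2r ?nnegrE
  ?normc_ge0 ?(abs_bdd_ge0 hM) //.
  apply: le_trans (mod_sum _ (fun k => b k * cis t ^+ k)) _.
  apply: le_trans (hM n); apply: ler_sum => i _.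
  by rewrite modM modX mod_cis expr1n mulr1.
move=> _ _ h2; exact: (cvg_unique _ h2 h1).
Qed.

End ParsevalSeries.

(** * Power series *)

Section PowerSeries.
Variable R : realType.
Local Notation C := (Cplx R).
Local Notation mu := (@lebesgue_measure R).
Implicit Types (b c d : nat -> C) (r s t : R) (z w h : C).

Lemma geometric_sum_le (q : R) n : 0 <= q < 1 -> \sum_(k < n) q ^+ k <= (1 - q)^-1.
Proof.
move=> /andP[q0 q1]; have q1' : 0 < 1 - q by rewrite subr_gt0.
rewrite -[X in _ <= X]mul1r ler_pdivlMr //.
elim: n => [|n IH]; first by rewrite big_ord0 mul0r.
have -> : (\sum_(k < n.+1) q ^+ k) * (1 - q) = 1 - q ^+ n.+1.
  elim: {IH} n => [|n IH]; first by rewrite big_ord_recr big_ord0 /= expr0 expr1; ring.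
  by rewrite big_ord_recr /= mulrDl IH !exprS; ring.
by rewrite gerBl exprn_ge0.
Qed.

(** Says that the radius of convergence is at least [r], through absolute bounds at each smaller
    radius; nothing is claimed at [r] itself. *)
Definition radge c r := forall s, 0 <= s < r ->
  exists M, forall n, \sum_(k < n) normc (c k) * s ^+ k <= M.

Lemma geometric_series_le c r (B s : R) n : 0 <= s < r ->
  (forall k, normc (c k) * r ^+ k <= B) ->
  \sum_(k < n) normc (c k) * s ^+ k <= B * (1 - s / r)^-1.
Proof.
move=> /andP[s0 sr] hB; have r0 : 0 < r by apply: le_lt_trans sr.
have B0 : 0 <= B by apply: le_trans (hB 0%N); rewrite mulr_ge0 ?normc_ge0 ?exprn_ge0 //
  ltW.
apply: le_trans (_ : B * \sum_(k < n) (s / r) ^+ k <= _); last first.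
  by rewrite ler_wpM2l // geometric_sum_le // divr_ge0 ?(ltW r0) //= ltr_pdivrMr // mul1r.
rewrite mulr_sumr; apply: ler_sum => k _.
rewrite exprMn exprVn mulrCA [X in _ <= X]mulrC; rewrite [X in X <= _]mulrC.
have rk : 0 < r ^+ k by rewrite exprn_gt0.
rewrite [X in _ <= X](_ : _ = (B / r ^+ k) * s ^+ k); last by ring.
by rewrite [X in X <= _]mulrC ler_wpM2r ?exprn_ge0 // ler_pdivlMr.
Qed.

Lemma radge_bounded c r (B : R) : (forall k, normc (c k) * r ^+ k <= B) -> radge c r.
Proof. by move=> hB s sr; eexists => n; exact: geometric_series_le sr hB. Qed.

(** Abel's lemma: convergence at a radius midway between [s] and [r] bounds the terms there, and the
    geometric loss from that radius down to [s] makes them absolutely summable. *)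
Lemma radge_csum c r :
  (forall z, normc z < r -> exists l, has_csum (fun n => c n * z ^+ n) l) -> radge c r.
Proof.
move=> h s /andP[s0 sr]; pose q := (s + r) / 2.
have q0 : 0 <= q by rewrite /q; lra.
have [|l /has_csum_bounded [B hB]] := h (q%:C); first by rewrite mod_real ger0_norm /q
  //; lra.
apply: (@radge_bounded c q B _ s) => [k|]; last by rewrite s0 /q; lra.
by have := hB k; rewrite modM modX mod_real ger0_norm.
Qed.

Lemma radge_abs_bdd c r z : radge c r -> normc z < r ->
  exists M, abs_bdd (fun n => c n * z ^+ n) M.
Proof.
move=> h zr; have [|M hM] := h (normc z); first by rewrite normc_ge0.
exists M => n; apply: le_trans (hM n); apply: ler_sum => k _; by rewrite modM modX.
Qed.

Lemma radge_has_csum c r z : radge c r -> normc z < r ->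
  exists l, has_csum (fun n => c n * z ^+ n) l.
Proof. by move=> h /(radge_abs_bdd h)[M]; exact: abs_bdd_csum. Qed.

(** One square in Parseval's sum is at most the whole sum, which is the mean of [normc (g t) ^+ 2]
    and hence at most [B ^+ 2]. *)
Lemma cauchy_estimate c s (M B : R) (g : R -> C) n :
  (forall n, \sum_(k < n) normc (c k) * s ^+ k <= M) -> 0 <= s ->
  (forall t, has_csum (fun n => c n * (s%:C * cis t) ^+ n) (g t)) ->
  (forall t, normc (g t) <= B) ->
  normc (c n) * s ^+ n <= B.
Proof.
move=> hM s0 hg hB.
pose b k : C := c k * s%:C ^+ k.
have bE k : normc (b k) = normc (c k) * s ^+ k by rewrite modM modX mod_real ger0_norm.
have hb : abs_bdd b M.
  by move=> m; apply: le_trans (hM m); apply: ler_sum => k _; rewrite bE.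
have hgb t : has_csum (fun k => b k * cis t ^+ k) (g t).
  by apply: has_csum_eq (hg t) => k; rewrite exprMn mulrA.
have B0 : 0 <= B by apply: le_trans (hB 0); exact: normc_ge0.
have pi2 : 0 < 2 * pi :> R by rewrite mulr_gt0 // pi_gt0.
have := parseval hb hgb => P.
have le1 : (\int[mu]_(t in `[0%R, (2 * pi)%R]) (normc (g t) ^+ 2)%:E <=
    (2 * pi)%:E * (B ^+ 2)%:E)%E.
  have -> : ((2 * pi)%:E * (B ^+ 2)%:E = \int[mu]_(t in `[0%R, (2 * pi)%R]) (B ^+
    2)%:E)%E.
    rewrite integral_cst //= lebesgue_measure_itv /= lte_fin pi2 oppr0 addr0.
    by rewrite muleC.
  apply: ge0_le_integral => //=.
  - by move=> t _; rewrite lee_fin sqr_ge0.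
  - exact: (measurable_funS measurableT (@subsetT _ _) (measurable_trig_series hgb)).
  - by move=> t _; rewrite lee_fin ler_pXn2r ?nnegrE ?normc_ge0.
rewrite P lee_pmul2l ?lte_fin // in le1.
rewrite -bE -(ler_pXn2r (n := 2)) ?nnegrE ?normc_ge0 // -lee_fin.
apply: le_trans le1; rewrite (nneseriesD1 (n := n)) //; last by move=> k; rewrite
  lee_fin sqr_ge0.
by rewrite leeDl // nneseries_ge0 // => k _ _; rewrite lee_fin sqr_ge0.
Qed.

(** Cauchy's estimate with [B = 0] on the circle of radius [r / 2]. *)
Lemma pseries_eq0 c r : 0 < r ->
  (forall z, normc z < r -> has_csum (fun n => c n * z ^+ n) 0) -> forall n, c n = 0.
Proof.
move=> r0 h n.
have rc : radge c r by apply: radge_csum => z /h; exists 0.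
have s0 : 0 < r / 2 by rewrite divr_gt0.
have sr : r / 2 < r by lra.
have [|M hM] := rc (r / 2); first by rewrite ltW.
have := @cauchy_estimate c (r / 2) M 0 (fun=> 0) n hM (ltW s0).
have e : normc (0 : C) <= 0 by rewrite mod0.
move=> /(_ _ (fun=> e)) H; have : normc (c n) * (r / 2) ^+ n <= 0.
  apply: H => t; apply: h.
  by rewrite modM mod_cis mulr1 mod_real gtr0_norm.
rewrite pmulr_lle0 ?exprn_gt0 // => cn; apply/eqP.
by rewrite -normc_eq0 eq_le cn normc_ge0.
Qed.

Lemma pseries_unique c d r (f : C -> C) : 0 < r ->
  (forall z, normc z < r -> has_csum (fun n => c n * z ^+ n) (f z)) ->
  (forall z, normc z < r -> has_csum (fun n => d n * z ^+ n) (f z)) -> c = d.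
Proof.
move=> r0 hc hd; apply/funext => n; apply/eqP; rewrite -subr_eq0; apply/eqP.
apply: (@pseries_eq0 (fun n => c n - d n) r r0) => z zr.
rewrite -[0](subrr (f z)) -[X in _ - X]mul1r -mulNr.
apply: has_csum_eq (has_csumD (hc z zr) (has_csumZ (-1) (hd z zr))) => k.
by rewrite mulN1r mulrBl.
Qed.

Lemma binomial_trunc (x y : R) n m : 0 <= x -> 0 <= y ->
  \sum_(k < m) 'C(n, k)%:R * x ^+ (n - k) * y ^+ k <= (x + y) ^+ n.
Proof.
move=> x0 y0; pose F k := 'C(n, k)%:R * x ^+ (n - k) * y ^+ k.
have F0 k : 0 <= F k by rewrite /F !mulr_ge0 ?exprn_ge0 ?ler0n.
have -> : (x + y) ^+ n = \sum_(k < n.+1) F k.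
  by rewrite exprDn; apply: eq_bigr => i _; rewrite /F -mulr_natl mulrA.
apply: le_trans (_ : \sum_(k < maxn m n.+1) F k <= _).
  rewrite -(subnKC (leq_maxl m n.+1)) big_split_ord /= lerDl sumr_ge0 //.
rewrite -(subnKC (leq_maxr m n.+1)) big_split_ord /= [X in _ + X]big1 ?addr0 //.
by move=> i _; rewrite /F bin_small ?mul0r // ltn_addr.
Qed.

Lemma mod_natr n : normc (n%:R : C) = n%:R.
Proof. by rewrite modMn (_ : normc 1 = 1) //; exact: normc1. Qed.

(** The coefficient of [h ^+ k] in [c n * (w + h) ^+ n]. For [n < k] the binomial coefficient
    vanishes, so the truncated subtraction in the exponent is harmless. *)
Definition rterm c w k n : C := 'C(n, k)%:R * c n * w ^+ (n - k).

Lemma rterm_rect c w (h : R) (M : R) :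
  0 <= h -> (forall n, \sum_(k < n) normc (c k) * (normc w + h) ^+ k <= M) ->
  forall m n, \sum_(k < m) \sum_(j < n) normc (rterm c w k j) * h ^+ k <= M.
Proof.
move=> h0 hM m n; apply: le_trans (hM n); rewrite exchange_big /=; apply: ler_sum => j _.
apply: le_trans (_ : normc (c j) * \sum_(k < m) 'C(j, k)%:R * normc w ^+ (j - k) * h ^+
  k <= _).
  rewrite mulr_sumr; apply: ler_sum => k _; rewrite /rterm !modM modX mod_natr.
  by rewrite le_eqVlt; apply/orP; left; apply/eqP; ring.
by rewrite ler_wpM2l ?normc_ge0 // binomial_trunc ?normc_ge0.
Qed.

Lemma rterm_row c w (h : R) (M : R) k :
  0 <= h -> (forall n, \sum_(k < n) normc (c k) * (normc w + h) ^+ k <= M) ->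
  forall n, (\sum_(j < n) normc (rterm c w k j)) * h ^+ k <= M.
Proof.
move=> h0 hM n; apply: le_trans (rterm_rect h0 hM k.+1 n).
rewrite big_ord_recr /= -mulr_suml lerDr sumr_ge0 // => i _.
by rewrite sumr_ge0 // => j _; rewrite mulr_ge0 ?normc_ge0 ?exprn_ge0.
Qed.

(** The binomial theorem bounds the absolute sums of the double family [rterm], so its two orders of
    summation agree. The second clause keeps the constant [M] without loss; [local_expansion_near]
    needs such a quantitative bound. *)
Lemma recenter c r w : radge c r -> normc w < r ->
  exists d, [/\ forall k, has_csum (rterm c w k) (d k),
   forall (h M : R), 0 <= h -> (forall n, \sum_(k < n) normc (c k) * (normc w + h) ^+ k
     <= M) ->
     forall k, normc (d k) * h ^+ k <= M &
   forall h l, normc w + normc h < r -> has_csum (fun n => c n * (w + h) ^+ n) l ->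
     has_csum (fun k => d k * h ^+ k) l].
Proof.
move=> rc wr; pose y := (r - normc w) / 2.
have y0 : 0 < y by rewrite /y divr_gt0 // subr_gt0.
have [|M0 hM0] := rc (normc w + y); first by rewrite addr_ge0 ?normc_ge0 ?ltW //= /y; lra.
have hex k : exists l, has_csum (rterm c w k) l.
  apply: (@abs_bdd_csum _ _ (M0 / y ^+ k)) => n.
  by rewrite ler_pdivlMr ?exprn_gt0 //; exact: rterm_row (ltW y0) hM0 n.
have [d hd] := choice hex.
exists d; split => //.
  move=> h M h0 hM k.
  rewrite (_ : normc (d k) * h ^+ k = normc (h%:C ^+ k * d k)); last first.
    by rewrite modM modX mod_real ger0_norm // mulrC.
  apply: abs_bdd_le (has_csumZ _ (hd k)) => n.
  apply: le_trans (rterm_row k h0 hM n); rewrite mulr_suml; apply: ler_sum => j _.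
  by rewrite modM modX mod_real ger0_norm // mulrC.
move=> h l whr hl.
have [|M hM] := rc (normc w + normc h); first by rewrite whr addr_ge0 ?normc_ge0.
apply: (@has_csum_exchange _ (fun n k => rterm c w k n * h ^+ k) M _ _ l _ _ _ hl).
- move=> m n; apply: le_trans (rterm_rect (normc_ge0 h) hM n m); rewrite exchange_big /=.
  by apply: ler_sum => i _; apply: ler_sum => j _; rewrite modM modX.
- move=> n; have -> : c n * (w + h) ^+ n = \sum_(k < n.+1) rterm c w k n * h ^+ k.
    rewrite exprDn mulr_sumr; apply: eq_bigr => i _.
    by rewrite /rterm -mulr_natl; ring.
  by apply: has_csum_fin => k nk; rewrite /rterm bin_small ?mul0r.
- move=> k; rewrite mulrC; apply: has_csum_eq (has_csumZ (h ^+ k) (hd k)) => n.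
  by rewrite mulrC.
Qed.

End PowerSeries.

(** * Global expansion of analytic functions on the disk *)

Section Weierstrass.
Variable R : realType.
Local Notation C := (Cplx R).
Implicit Types (c d : nat -> C) (r s t : R) (z w h : C) (F : C -> C).

(** The radius [e] and the coefficient bound [M] are explicit because compactness of a circle has to
    make both of them uniform in the center. *)
Definition local_expansion F z0 (e M : R) := exists d,
  (forall k, normc (d k) * e ^+ k <= M) /\
  (forall h, normc h < e -> has_csum (fun n => d n * h ^+ n) (F (z0 + h))).

Lemma local_expansionW F z0 (e e' M M' : R) : 0 <= e' <= e -> M <= M' ->
  local_expansion F z0 e M -> local_expansion F z0 e' M'.
Proof.
move=> /andP[e0 ee] MM [d [hd hF]]; exists d; split=> [k|h he].
  apply: le_trans MM; apply: le_trans (hd k).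
  by rewrite ler_wpM2l ?normc_ge0 // lerXn2r ?nnegrE // (le_trans e0).
by apply: hF; exact: lt_le_trans ee.
Qed.

(** Since [normc w + e / 4 <= e / 2], the geometric series involved has ratio at most one half; its
    sum gives the factor 2. *)
Lemma local_expansion_near F z0 (e M : R) w : 0 < e -> normc w <= e / 4 ->
  local_expansion F z0 e M -> local_expansion F (z0 + w) (e / 4) (2 * M).
Proof.
move=> e0 we [d [hd hF]].
have M0 : 0 <= M by apply: le_trans (hd 0%N); rewrite mulr_ge0 ?normc_ge0.
have we' : normc w < e by lra.
have rd : radge d e by exact: radge_bounded hd.
have [d' [_ hd' hs]] := recenter rd we'.
exists d'; split=> [k|h he].
  apply: (hd' (e / 4)); first by lra.
  move=> n.
  have nw := normc_ge0 w.
  have hh : 0 <= normc w + e / 4 < e by apply/andP; split; lra.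
  apply: le_trans (geometric_series_le n hh hd) _.
  rewrite mulrC ler_wpM2r // invf_ple ?posrE //; last first.
    by rewrite subr_gt0 ltr_pdivrMr // mul1r; case/andP: hh.
  rewrite lerBrDr -lerBrDl ler_pdivrMr //.
  by rewrite (_ : 1 - 2^-1 = 2^-1 :> R); [lra|lra].
rewrite -addrA; apply: hs; first by lra.
by apply: hF; apply: le_lt_trans (modD _ _) _; lra.
Qed.

Lemma unit_cis z : normc z = 1 -> exists2 t, 0 <= t <= 2 * pi & z = cis t.
Proof.
case: z => p q z1; have pq : p ^+ 2 + q ^+ 2 = 1.
  by have := sqr_mod (p +i* q : C); rewrite z1 expr1n.
have p1 : -1 <= p <= 1.
  by rewrite -ler_norml -(ler_pXn2r (n := 2)) ?nnegrE // real_normK ?num_real // expr1n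
    -pq lerDl sqr_ge0.
have cp : cos (acos p) = p by apply: acosK; rewrite in_itv.
have pi0 : 0 <= pi :> R by exact: pi_ge0.
have a0 := acos_ge0 p1; have api := acos_lepi p1.
have sq : sin (acos p) = `|q|.
  rewrite sin_acos //; have -> : 1 - p ^+ 2 = q ^+ 2 by rewrite -pq; ring.
  exact: sqrtr_sqr.
case: (leP 0 q) => q0.
  exists (acos p); first by apply/andP; split; lra.
  by rewrite /cis cp sq ger0_norm.
exists (2 * pi - acos p); first by apply/andP; split; lra.
rewrite /cis cosB sinB cp sq ltr0_norm //.
have -> : 2 * pi = pi *+ 2 :> R by rewrite mulr_natl.
by rewrite cos2pi sin2pi; congr (_ +i* _); ring.
Qed.

Lemma unit_decomp z : exists2 t, 0 <= t <= 2 * pi & z = (normc z)%:C * cis t.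
Proof.
have [->|z0] := eqVneq z 0.
  exists 0; last by rewrite mod0 mul0r.
  by rewrite lexx mulr_ge0 // pi_ge0.
have nz : normc z != 0 by rewrite normc_eq0.
have rz : (normc z)%:C != 0 :> C.
  by rewrite -normc_eq0 mod_real normr_eq0.
have [|t tI ht] := @unit_cis ((normc z)^-1%:C * z).
  by rewrite modM mod_real ger0_norm ?invr_ge0 ?normc_ge0 // mulVf.
exists t => //; rewrite -ht mulrA -[_%:C * _%:C]rmorphM /= divff //.
by rewrite mul1r.
Qed.

Lemma cis_dist s t : normc (cis s - cis t) <= `|cos s - cos t| + `|sin s - sin t|.
Proof. exact: mod_le_ReIm. Qed.

(** A single integer controls both constants, [n.+1%:R^-1] being the radius and [n.+1%:R] the bound.
    Near each angle every large [n] works, and compactness of the interval of angles, in its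
    near-covering form, yields one [n] for all. *)
Lemma uniform_local_expansion F (rho : R) : 0 < rho ->
  (forall z, normc z = rho -> exists e M : R, 0 < e /\ local_expansion F z e M) ->
  exists e M : R, 0 < e /\ forall t, 0 <= t <= 2 * pi -> local_expansion F (rho%:C * cis
    t) e M.
Proof.
move=> rho0 hloc.
have cK := @segment_compact R 0 (2 * pi).
pose P (n : nat) (t : R) := local_expansion F (rho%:C * cis t) n.+1%:R^-1 n.+1%:R.
suff : \forall n \near \oo, `[0, 2 * pi]%classic `<=` P n.
  move=> [N _ /(_ N (leqnn _)) hN]; exists N.+1%:R^-1, N.+1%:R; split=> //; exact: hN.
have /compact_near_coveringP NC := cK; apply: (NC nat \oo P _) => t0 _.
have [|e [M [e0 hM]]] := hloc (rho%:C * cis t0).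
  by rewrite modM mod_cis mulr1 mod_real gtr0_norm.
have e4 : 0 < e / 4 / (2 * rho) by rewrite !divr_gt0 // mulr_gt0.
have nearT : \forall t \near t0, normc (cis t - cis t0) <= e / 4 / rho.
  have /cvgrPdist_lt/(_ _ e4) h1 := @continuous_cos R t0.
  have /cvgrPdist_lt/(_ _ e4) h2 := @continuous_sin R t0.
  near=> t; apply: le_trans (cis_dist _ _) _.
  have l1 : `|cos t - cos t0| < e / 4 / (2 * rho) by rewrite distrC; near: t.
  have l2 : `|sin t - sin t0| < e / 4 / (2 * rho) by rewrite distrC; near: t.
  apply: le_trans (ltW (ltrD l1 l2)) _.
  by rewrite le_eqVlt; apply/orP; left; apply/eqP; field; rewrite gt_eqF.
have nearN : \forall n \near \oo, n.+1%:R^-1 <= e / 4 /\ 2 * M <= n.+1%:R :> R.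
  near=> n; have n1 : (e / 4)^-1 <= n%:R by near: n; exact: nbhs_infty_ger.
  have n2 : 2 * M <= n%:R by near: n; exact: nbhs_infty_ger.
  have nn : n%:R <= n.+1%:R :> R by rewrite ler_nat.
  split; last exact: le_trans n2 nn.
  by rewrite invf_ple ?posrE ?divr_gt0 // (le_trans n1).
exists ([set t | normc (cis t - cis t0) <= e / 4 / rho],
        [set n : nat | n.+1%:R^-1 <= e / 4 /\ 2 * M <= n.+1%:R :> R]) => //=.
move=> [t n] /= [ht [hn1 hn2]]; rewrite /P.
have -> : rho%:C * cis t = rho%:C * cis t0 + rho%:C * (cis t - cis t0) by ring.
apply: (local_expansionW _ hn2); last first.
  apply: local_expansion_near hM => //.
  by rewrite modM mod_real gtr0_norm // mulrC -ler_pdivlMr.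
by rewrite hn1 invr_ge0 ler0n.
Unshelve. all: by end_near. Qed.

End Weierstrass.

Section Global.
Variable R : realType.
Local Notation C := (Cplx R).
Implicit Types (c d : nat -> C) (r s t : R) (z w h : C) (F : C -> C).

(** Halving [y] brings the [k]-th binomial term down to at most [B * 2^-1 ^+ k], and these bounds
    add up to at most [2 * B]. *)
Lemma binomial_bound (x y B a : R) n : 0 <= x -> 0 < y -> 0 <= B ->
  (forall k, (k <= n)%N -> 'C(n, k)%:R * a * x ^+ (n - k) * y ^+ k <= B) ->
  a * (x + y / 2) ^+ n <= 2 * B.
Proof.
move=> x0 y0 B0 h; rewrite exprDn mulr_sumr.
apply: le_trans (_ : \sum_(k < n.+1) B * 2^-1 ^+ k <= _).
  apply: ler_sum => k _; have := h k (ltn_ord k).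
  move=> /(ler_wpM2r (_ : 0 <= 2^-1 ^+ k)) => /(_ (exprn_ge0 _ _)); rewrite invr_ge0
    ler0n => /(_ isT).
  apply: le_trans; rewrite le_eqVlt; apply/orP; left; apply/eqP.
  by rewrite -mulr_natl exprMn; ring.
rewrite -mulr_sumr mulrC ler_wpM2r //.
have := @geometric_sum_le R 2^-1 n.+1; rewrite (_ : (1 - 2^-1)^-1 = 2 :> R); last by
  field.
by apply; rewrite invr_ge0 ler0n invf_lt1 // ltr1n.
Qed.

(* The Taylor coefficients of order [k] of [F] on a circle of radius [s] close to
   [rho] are uniformly at most [M / e^k].  As functions of the center they are
   power series with coefficients [C(n, k) c_n], so Cauchy's estimate gives
   [C(n, k) |c_n| s^(n - k) e^k <= M], and summing over [k] shows that the
   expansion at [0] converges beyond [rho]. *)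
Lemma pseries_extend F c (rho : R) : 0 < rho ->
  (forall z, normc z < rho -> has_csum (fun n => c n * z ^+ n) (F z)) ->
  (forall z, normc z = rho -> exists e M : R, 0 < e /\ local_expansion F z e M) ->
  exists2 rho', rho < rho' &
    forall z, normc z < rho' -> has_csum (fun n => c n * z ^+ n) (F z).
Proof.
move=> rho0 hF /(uniform_local_expansion rho0)[e0 [M0 [e0gt0 hU]]].
pose e := e0 / 4; have egt0 : 0 < e by rewrite divr_gt0.
(* The first bound keeps [s = rho - y] positive. The second keeps the circle of radius [s] within
   reach of the uniform expansions, and makes [s + e / 2] exceed [rho]. *)
pose y := Num.min (rho / 2) (e / 4).
have y0 : 0 < y by rewrite lt_min !divr_gt0.
have yr : y <= rho / 2 by rewrite ge_min lexx.
have ye : y <= e / 4 by rewrite ge_min lexx orbT.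
pose s := rho - y; have s0 : 0 < s by rewrite /s; lra.
have srho : s < rho by rewrite /s; lra.
have rc : radge c rho by apply: radge_csum => z /hF; exists (F z).
have modw t : normc (s%:C * cis t) = s by rewrite modM mod_cis mulr1 mod_real gtr0_norm.
have locw t : 0 <= t <= 2 * pi -> local_expansion F (s%:C * cis t) e (2 * M0).
  move=> /hU /(local_expansion_near e0gt0 (w := (- y)%:C * cis t)).
  rewrite -mulrDl -rmorphD; apply; rewrite modM mod_cis mulr1 mod_real normrN gtr0_norm
    //.
  by rewrite /e in ye; lra.
have M0ge : 0 <= 2 * M0.
  have [|d [hd _]] := locw 0; first by rewrite lexx mulr_ge0 // pi_ge0.
  by apply: le_trans (hd 0%N); rewrite mulr_ge0 ?normc_ge0.
(* The expansions of [F] at the points of the circle of radius [s] are the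
   recentered series, by uniqueness. *)
have coefw k t : 0 <= t <= 2 * pi ->
    exists2 l, has_csum (rterm c (s%:C * cis t) k) l & normc l * e ^+ k <= 2 * M0.
  move=> /locw [d' [hd' hF']].
  have [|d [hd _ hs]] := @recenter _ c rho (s%:C * cis t) rc; first by rewrite modw.
  exists (d k) => //; suff -> : d = d' by [].
  apply: (@pseries_unique _ d d' (Num.min e (rho - s)) (fun h => F (s%:C * cis t + h))).
  - by rewrite lt_min egt0 subr_gt0.
  - move=> h; rewrite lt_min => /andP[_ hh]; apply: hs; first by rewrite modw; lra.
    by apply: hF; apply: le_lt_trans (modD _ _) _; rewrite modw; lra.
  - by move=> h; rewrite lt_min => /andP[hh _]; exact: hF'.
have coef_bound n k : (k <= n)%N ->
    'C(n, k)%:R * normc (c n) * s ^+ (n - k) * e ^+ k <= 2 * M0.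
  move=> kn; pose b n : C := 'C(n, k)%:R * c n.
  have [|M1 hM1] := rc (s + y / 2); first by rewrite /s; apply/andP; split; lra.
  have hb m : \sum_(j < m) normc (b j) * s ^+ j <= M1 / (y / 2) ^+ k * s ^+ k.
    have y20 : 0 <= y / 2 by rewrite divr_ge0 // ltW.
    have modsC : normc (s%:C : C) = s by rewrite mod_real gtr0_norm.
    have hM1' n0 : \sum_(j < n0) normc (c j) * (normc (s%:C : C) + y / 2) ^+ j <= M1.
      by rewrite modsC.
    have := rterm_row k y20 hM1' m; rewrite -ler_pdivlMr ?exprn_gt0 ?divr_gt0 // =>
      /(ler_wpM2r (exprn_ge0 k (ltW s0))).
    apply: le_trans; rewrite mulr_suml; apply: ler_sum => j _.
    rewrite /rterm /b !modM modX mod_real gtr0_norm // mod_natr.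
    case: (leqP k j) => kj; last by rewrite bin_small // !mul0r.
    by rewrite -[X in _ <= X]mulrA -exprD subnK.
  have hl t : exists l, has_csum (fun j => b j * (s%:C * cis t) ^+ j) l /\ normc l <= 2
    * M0 * (s / e) ^+ k.
    (* The uniform bounds cover one period only, so [t] is replaced by a representative in it.
       Multiplying by the [k]-th power of the center then restores the exponent from [n - k] to [n],
       which gives a power series in the center with coefficients [b]. *)
    have [t' tI ht'] := unit_cis (mod_cis t).
    have [l hl hle] := coefw k t' tI; exists ((s%:C * cis t') ^+ k * l); split.
      apply: has_csum_eq (has_csumZ _ hl) => j; rewrite /rterm /b -ht'.
      case: (leqP k j) => kj; last by rewrite bin_small // !mul0r mulr0.
      by rewrite [LHS]mulrC -[LHS]mulrA -exprD subnK.
    rewrite -ler_pdivlMr ?exprn_gt0 // in hle.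
    rewrite modM modX modw expr_div_n [X in _ <= X]mulrCA ler_wpM2l //.
    by rewrite exprn_ge0 // ltW.
  have [g hg] := choice hl.
  have := @cauchy_estimate _ b s _ _ g n hb (ltW s0) (fun t => (hg t).1) (fun t => (hg
    t).2).
  rewrite /b modM mod_natr expr_div_n mulrA ler_pdivlMr ?exprn_gt0 //.
  have -> : s ^+ n = s ^+ (n - k) * s ^+ k by rewrite -exprD subnK.
  move=> H.
  rewrite -(ler_pM2r (exprn_gt0 k s0)); apply: le_trans H.
  by rewrite le_eqVlt; apply/orP; left; apply/eqP; ring.
have rc' : radge c (s + e / 2).
  apply: (@radge_bounded _ _ _ (2 * (2 * M0))) => n.
  apply: binomial_bound => // [|k kn]; [exact: ltW|].
  exact: coef_bound.
exists (s + e / 2); first by rewrite /s; lra.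
move=> z hz; case: (ltP (normc z) s) => zs; first by apply: hF; exact: lt_trans srho.
(* Convergence beyond [rho] does not yet identify the sum with [F z]. The series is recentered at
   the point of modulus [s] on the ray of [z], where uniqueness matches it with the local expansion
   of [F]. *)
have [t tI zE] := unit_decomp z; have [d' [_ hF']] := locw t tI.
have [|d [hd _ hs]] := @recenter _ c (s + e / 2) (s%:C * cis t) rc'.
  by rewrite modw; lra.
have dE : d = d'.
  apply: (@pseries_unique _ d d' (Num.min (e / 2) (rho - s)) (fun h => F (s%:C * cis t +
    h))).
  - by rewrite lt_min divr_gt0 // subr_gt0.
  - move=> h; rewrite lt_min => /andP[he hh]; apply: hs; first by rewrite modw; lra.
    by apply: hF; apply: le_lt_trans (modD _ _) _; rewrite modw; lra.
  - by move=> h; rewrite lt_min => /andP[hh _]; apply: hF'; lra.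
pose h : C := (normc z - s)%:C * cis t.
have modh : normc h = normc z - s by rewrite modM mod_cis mulr1 mod_real ger0_norm //
  subr_ge0.
have zh : s%:C * cis t + h = z by rewrite /h -mulrDl -rmorphD addrC subrK -zE.
have [l hl] := radge_has_csum rc' hz.
have := hs h l; rewrite modh modw zh => /(_ _ hl) => H.
have h1 : has_csum (fun k => d k * h ^+ k) l by apply: H; lra.
have h2 : has_csum (fun k => d k * h ^+ k) (F z).
  by rewrite dE -zh; apply: hF'; rewrite modh; lra.
by rewrite (has_csum_unique h2 h1).
Qed.

(** If the supremum of the radii, capped at 1, on which the expansion at 0 represents [F] were less
    than 1, [pseries_extend] would exceed it. *)
Lemma pseries_global F :
  (forall z, normc z < 1 -> exists e M : R, 0 < e /\ local_expansion F z e M) ->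
  exists c, forall z, normc z < 1 -> has_csum (fun n => c n * z ^+ n) (F z).
Proof.
move=> hloc; have [|e [M [e0 [c [_ hc]]]]] := hloc 0; first by rewrite mod0.
exists c; pose A : set R := [set r | r <= 1 /\
  forall z, normc z < r -> has_csum (fun n => c n * z ^+ n) (F z)].
pose e1 := Num.min e 1.
have A1 : A e1.
  split; first by rewrite ge_min lexx orbT.
  by move=> z; rewrite lt_min => /andP[/hc]; rewrite add0r.
have supA : has_sup A by split; [exists e1|exists 1 => r []].
have e1sup : e1 <= sup A by exact: sup_upper_bound.
have sup0 : 0 < sup A by apply: lt_le_trans e1sup; rewrite lt_min e0 ltr01.
have Asup z : normc z < sup A -> has_csum (fun n => c n * z ^+ n) (F z).
  move=> hz; have zs : 0 < sup A - normc z by rewrite subr_gt0.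
  have [r [_ hr] zr] := sup_adherent zs supA; apply: hr; move: zr; lra.
case: (ltP (sup A) 1) => sup1; last by move=> z z1; apply: Asup; exact: lt_le_trans sup1.
have [z hz|rho' rr h'] := pseries_extend sup0 Asup.
  by apply: hloc; rewrite hz.
have : A (Num.min rho' 1).
  split; first by rewrite ge_min lexx orbT.
  by move=> z; rewrite lt_min => /andP[/h'].
by move=> /(sup_upper_bound supA); rewrite ge_min leNgt rr /= leNgt sup1.
Qed.

Definition has_coefs (f : disk R -> C) c :=
  forall z : disk R, has_csum (fun n => c n * val z ^+ n) (f z).

Lemma ext0E (f : disk R -> C) (z : disk R) : ext0 f (val z) = f z.
Proof. by rewrite /ext0 valK. Qed.

Lemma analytic_has_coefs (f : disk R -> C) : analytic f -> exists c, has_coefs f c.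
Proof.
move=> hf; have [z0 z01|c hc] := @pseries_global (ext0 f).
  have [c [r [r0 hc]]] := hf (exist _ z0 z01).
  (* The radius is cut so that the neighborhood stays in the disk, where [ext0 f] agrees with
     [f]. *)
  pose r1 := Num.min r (1 - normc z0).
  have r10 : 0 < r1 by rewrite lt_min r0 subr_gt0.
  have hs h : normc h < r1 -> has_csum (fun n => c n * h ^+ n) (ext0 f (z0 + h)).
    rewrite lt_min => /andP[hr h1].
    have z1 : normc (z0 + h) < 1 by apply: le_lt_trans (modD _ _) _; lra.
    have := hc (exist _ (z0 + h) z1); rewrite /= addrAC subrr add0r => /(_ hr) /has_csumE.
    by rewrite -[z0 + h]/(val (exist (fun z : C => is_true (normc z < 1)) (z0 + h) z1))
      ext0E.
  have rc : radge c r1 by apply: radge_csum => z /hs; eexists; eassumption.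
  have [|M hM] := rc (r1 / 2); first by apply/andP; split; lra.
  exists (r1 / 2), M; split; first by rewrite divr_gt0.
  exists c; split=> [k|h hh]; last by apply: hs; lra.
  apply: le_trans (hM k.+1); rewrite big_ord_recr /= lerDr sumr_ge0 // => i _.
  by rewrite mulr_ge0 ?normc_ge0 ?exprn_ge0 // ltW // divr_gt0.
exists c => z; have := hc (val z) (valP z); by rewrite ext0E.
Qed.

Lemma has_coefs_radge f c : has_coefs f c -> radge c 1.
Proof.
move=> h; apply: radge_csum => z z1; exists (f (exist _ z z1)).
exact: h (exist _ z z1).
Qed.

Lemma has_coefs_analytic f c : has_coefs f c -> analytic f.
Proof.
move=> h z0; have rc := has_coefs_radge h.
have z01 : normc (val z0) < 1 by exact: valP z0.
have [d [_ _ hd]] := recenter rc z01.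
exists d, (1 - normc (val z0)); split; first by rewrite subr_gt0.
move=> z hz; apply/has_csumE; apply: hd; first by lra.
by rewrite addrC subrK; exact: h.
Qed.

End Global.

(** * Composition with the affine map *)

Section Schur.
Variable R : realType.
Local Notation C := (Cplx R).
Implicit Types (c d : nat -> C) (r s t q : R) (z w h : C).

(** Values in [\bar R] allow the radius 1, where the sum may be infinite; [hmean c 1] is the
    quantity that dominates both squared norms. *)
Definition hmean c r : \bar R := (\sum_(n <oo) ((normc (c n) * r ^+ n) ^+ 2)%:E)%E.

Lemma hmean_ge0 c r : (0 <= hmean c r)%E.
Proof. by apply: nneseries_ge0 => n _ _; rewrite lee_fin sqr_ge0. Qed.

Lemma hmean_partial c r n : ((\sum_(k < n) (normc (c k) * r ^+ k) ^+ 2)%:E <= hmean c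
  r)%E.
Proof.
rewrite -sumEFin -(big_mkord xpredT (fun k => ((normc (c k) * r ^+ k) ^+ 2)%:E)).
by apply: nneseries_lim_ge => k _ _; rewrite lee_fin sqr_ge0.
Qed.

Lemma hmean_le c r (x : \bar R) :
  (forall n, ((\sum_(k < n) (normc (c k) * r ^+ k) ^+ 2)%:E <= x)%E) -> (hmean c r <=
    x)%E.
Proof.
move=> h; apply: lime_le.
  by apply: is_cvg_nneseries => n _ _; rewrite lee_fin sqr_ge0.
by apply: nearW => n; rewrite sumEFin big_mkord.
Qed.

Lemma hmean_mono c r s : 0 <= r <= s -> (hmean c r <= hmean c s)%E.
Proof.
move=> /andP[r0 rs]; apply: hmean_le => n; apply: le_trans (hmean_partial c s n).
rewrite lee_fin; apply: ler_sum => k _.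
rewrite ler_pXn2r ?nnegrE ?mulr_ge0 ?normc_ge0 ?exprn_ge0 ?(le_trans r0 rs) //.
by rewrite ler_wpM2l ?normc_ge0 // lerXn2r ?nnegrE // (le_trans r0).
Qed.

Lemma cauchy_schwarz_weighted (A e : nat -> R) n : (forall k, 0 <= A k) ->
  (\sum_(k < n) A k * e k) ^+ 2 <= (\sum_(k < n) A k) * (\sum_(k < n) A k * e k ^+ 2).
Proof.
move=> A0; elim: n => [|n IH]; first by rewrite !big_ord0 expr0n mulr0.
rewrite !big_ord_recr /=.
have S0 : 0 <= \sum_(k < n) A k by rewrite sumr_ge0.
have Q0 : 0 <= \sum_(k < n) A k * e k ^+ 2.
  by rewrite sumr_ge0 // => i _; rewrite mulr_ge0 // sqr_ge0.
move: IH S0 Q0 (A0 n); set S := \sum_(k < n) A k; set Q := \sum_(k < n) _ * _ ^+ 2.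
set P := \sum_(k < n) _; move: (A n) (e n) => x y IH S0 Q0 x0.
(* This is the cross term of the inductive step. It follows from [P ^+ 2 <= S * Q] and the
   inequality between the arithmetic and geometric means of [Q] and [S * y ^+ 2]. *)
have key : 2 * P * y <= Q + S * y ^+ 2.
  have Sy : 0 <= S * y ^+ 2 by rewrite mulr_ge0 // sqr_ge0.
  rewrite leNgt; apply/negP => lt1.
  have : (Q + S * y ^+ 2) ^+ 2 < (2 * P * y) ^+ 2.
    by rewrite ltr_pXn2r ?nnegrE ?addr_ge0 // ltW // (le_lt_trans _ lt1) // addr_ge0.
  have h1 : P ^+ 2 * y ^+ 2 <= S * Q * y ^+ 2 by rewrite ler_wpM2r // sqr_ge0.
  have := sqr_ge0 (Q - S * y ^+ 2); nra.
have := ler_wpM2l x0 key; nra.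
Qed.

(** Truncation of the series of [(1 - q) ^- k.+1]. Pascal's rule gives
    [T k.+1 n.+1 = T k n + q * T k.+1 n], so raising [k] by one costs one factor [1 - q]. *)
Lemma negative_binomial_le q k n : 0 <= q < 1 ->
  (\sum_(j < n) 'C(j, k)%:R * q ^+ (j - k)) * (1 - q) ^+ k.+1 <= 1.
Proof.
move=> /andP[q0 q1]; have q1' : 0 < 1 - q by rewrite subr_gt0.
elim: k n => [|k IH] n.
  rewrite expr1 -ler_pdivlMr // mul1r.
  apply: le_trans (geometric_sum_le n _); last by rewrite q0.
  by apply: ler_sum => i _; rewrite bin0 mul1r subn0.
case: n => [|n]; first by rewrite big_ord0 mul0r.
pose T k n := \sum_(j < n) 'C(j, k)%:R * q ^+ (j - k) : R.
have T0 i m : 0 <= T i m by rewrite sumr_ge0 // => j _; rewrite mulr_ge0 ?exprn_ge0.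
have TS : T k.+1 n.+1 = T k n + q * T k.+1 n.
  rewrite /T big_ord_recl bin0n mul0r add0r mulr_sumr -big_split /=.
  apply: eq_bigr => i _; rewrite /bump /= add1n binS subSS natrD mulrDl addrC; congr (_
    + _).
  case: (leqP k.+1 i) => ki; last by rewrite bin_small // !mul0r mulr0.
  by rewrite mulrCA -exprS subnSK.
have Tmono : T k.+1 n <= T k.+1 n.+1.
  by rewrite /T big_ord_recr lerDl mulr_ge0 ?exprn_ge0.
have : T k.+1 n.+1 * (1 - q) <= T k n.
  have h1 := ler_wpM2l q0 Tmono; rewrite mulrBr mulr1 {1}TS; lra.
rewrite exprS mulrA -/(T k.+1 n.+1) => h; apply: le_trans (IH n).
by rewrite ler_wpM2r // exprn_ge0 // ltW.
Qed.

Lemma cvg_sum_ord (u : nat -> nat -> R) (l : nat -> R) m :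
  (forall k, u k @ \oo --> l k) ->
  (fun n => \sum_(k < m) u k n) @ \oo --> \sum_(k < m) l k.
Proof.
move=> h; elim: m => [|m IH].
  rewrite big_ord0 (_ : (fun n => _) = fun=> 0); first exact: cvg_cst.
  by apply/funext => n; rewrite big_ord0.
rewrite big_ord_recr /= (_ : (fun n => _) = (fun n => \sum_(k < m) u k n) \+ u m).
  exact: cvgD.
by apply/funext => n; rewrite big_ord_recr.
Qed.

Variable a : R.
Hypothesis ha : 0 < a < 1.

(** With slope [a] instead of [a / 2] the value would be exactly [1 - a + a * r]. The rows in
    Schur's test would still be fine, but the column sums would be unbounded as [r] tends to 0. Half
    the slope keeps [contract r - (1 - a)] at least [a / 2]. *)
Definition contract r := 1 - a / 2 * (1 - r).

(* Schur's test: the row sums are bounded by the binomial theorem, the column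
   sums by the negative binomial series. *)
Lemma schur_finite c r m n : 0 <= r <= 1 ->
  \sum_(k < m) (normc (\sum_(j < n) rterm c (1 - a)%:C k j) * (a * r) ^+ k) ^+ 2 <=
  2 / a * \sum_(j < n) (normc (c j) * contract r ^+ j) ^+ 2.
Proof.
have /andP[a0 a1] := ha; move=> /andP[r0 r1].
set rho := contract r; pose x := 1 - a; pose y := a * r.
have x0 : 0 < x by rewrite /x subr_gt0.
have y0 : 0 <= y by rewrite /y mulr_ge0 // ltW.
have rho_x : a / 2 <= rho - x by rewrite /rho /x /contract; nra.
have xy : x + y <= rho by rewrite /rho /x /y /contract; nra.
have rho1 : rho <= 1 by rewrite /rho /contract; nra.
have rho0 : 0 < rho by lra.
pose A k j := 'C(j, k)%:R * x ^+ (j - k) * y ^+ k / rho ^+ j : R.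
have A0 k j : 0 <= A k j by rewrite /A !mulr_ge0 ?invr_ge0 ?exprn_ge0 ?ler0n // ltW.
pose e j := normc (c j) * rho ^+ j.
have row j : \sum_(k < m) A k j <= 1.
  rewrite -mulr_suml ler_pdivrMr ?exprn_gt0 // mul1r.
  apply: le_trans (binomial_trunc j m (ltW x0) y0) _.
  by rewrite lerXn2r ?nnegrE ?(addr_ge0 (ltW x0) y0) ?(ltW rho0).
have q01 : 0 <= x / rho < 1.
  by rewrite divr_ge0 ?ltW //= ltr_pdivrMr // mul1r; lra.
have col k : \sum_(j < n) A k j <= 2 / a.
  have h := negative_binomial_le k n q01.
  have q1 : 0 < 1 - x / rho by rewrite subr_gt0; case/andP: q01.
  have yq : y / rho <= 1 - x / rho.
    by rewrite lerBrDr -mulrDl ler_pdivrMr // mul1r addrC.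
  apply: le_trans (_ : (\sum_(j < n) 'C(j, k)%:R * (x / rho) ^+ (j - k)) * (1 - x / rho)
    ^+ k <= _).
    rewrite mulr_suml; apply: ler_sum => j _; rewrite /A.
    case: (leqP k j) => kj; last by rewrite bin_small // !mul0r.
    have -> : rho ^+ j = rho ^+ (j - k) * rho ^+ k by rewrite -exprD subnK.
    rewrite (_ : _ / _ = 'C(j, k)%:R * (x / rho) ^+ (j - k) * (y / rho) ^+ k); last first.
      by rewrite !expr_div_n invfM; ring.
    rewrite ler_wpM2l ?mulr_ge0 ?ler0n ?exprn_ge0 //; first by case/andP: q01.
    by rewrite lerXn2r ?nnegrE ?divr_ge0 // ltW.
  rewrite exprS [X in _ * X]mulrC mulrA -ler_pdivlMr // mul1r in h; apply: le_trans h _.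
  have -> : 1 - x / rho = (rho - x) / rho by rewrite [RHS]mulrBl divff // gt_eqF.
  rewrite invf_div ler_pdivrMr; last by lra.
  have a2 : 0 <= 2 / a by rewrite divr_ge0 // ltW.
  apply: le_trans (ler_wpM2l a2 rho_x); apply: le_trans rho1 _.
  by rewrite (_ : 2 / a * (a / 2) = 1) //; field; rewrite gt_eqF.
have entry k : normc (\sum_(j < n) rterm c (1 - a)%:C k j) * (a * r) ^+ k <= \sum_(j <
  n) A k j * e j.
  apply: le_trans (_ : (\sum_(j < n) normc (rterm c (1 - a)%:C k j)) * y ^+ k <= _).
    by rewrite ler_wpM2r ?exprn_ge0 //; exact: mod_sum.
  rewrite mulr_suml; apply: ler_sum => j _; rewrite /A /e /rterm !modM modX mod_natr
    mod_real.
  rewrite gtr0_norm // -/x le_eqVlt; apply/orP; left; apply/eqP.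
  by field; rewrite expf_neq0 // gt_eqF.
apply: le_trans (_ : \sum_(k < m) (2 / a) * \sum_(j < n) A k j * e j ^+ 2 <= _).
  apply: ler_sum => k _; apply: le_trans (_ : (\sum_(j < n) A k j * e j) ^+ 2 <= _).
    rewrite ler_pXn2r ?nnegrE ?mulr_ge0 ?normc_ge0 ?exprn_ge0 //.
    apply: sumr_ge0 => j _; apply: mulr_ge0 (A0 k j) _.
    by apply: mulr_ge0; [exact: normc_ge0|apply: exprn_ge0; exact: ltW].
  apply: le_trans (cauchy_schwarz_weighted e n (A0 k)) _; rewrite ler_wpM2r //.
  by rewrite sumr_ge0 // => j _; rewrite mulr_ge0 ?sqr_ge0.
rewrite -mulr_sumr ler_wpM2l ?divr_ge0 ?(ltW a0) //.
rewrite exchange_big /=; apply: ler_sum => j _; rewrite -mulr_suml.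
by rewrite -[X in _ <= X]mul1r ler_wpM2r ?sqr_ge0.
Qed.

Lemma has_coefs_comp f c : has_coefs f c ->
  exists2 d, has_coefs (comp_op (affine_map ha) f) d &
    forall r, 0 <= r <= 1 -> (hmean d r <= (2 / a)%:E * hmean c (contract r))%E.
Proof.
have /andP[a0 a1] := ha.
move=> hf; have rc := has_coefs_radge hf.
have modw : normc ((1 - a)%:C : C) = 1 - a by rewrite mod_real gtr0_norm // subr_gt0.
have [|d [hd _ hs]] := @recenter _ c 1 (1 - a)%:C rc; first by rewrite modw; lra.
exists (fun k => d k * a%:C ^+ k).
  move=> z; have z1 : normc (val z) < 1 := valP z.
  have := hs (a%:C * val z) (f (affine_map ha z)).
  rewrite modw modM mod_real gtr0_norm // => /(_ _ _) H.
  apply: has_csum_eq (H _ _) => [n||]; first by rewrite exprMn mulrA.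
    have : a * normc (val z) < a * 1 by rewrite ltr_pM2l.
    by lra.
  by have := hf (affine_map ha z); rewrite /= addrC.
move=> r r01; apply: hmean_le => m.
have r0 : 0 <= r by case/andP: r01.
(* The finite Schur bound is uniform in both truncations: [n] tends to infinity for fixed [m], after
   [hmean_le] has reduced the claim to each [m]. *)
pose X (n : nat) : R := \sum_(k < m) (normc (\sum_(j < n) rterm c (1 - a)%:C k j) * (a *
  r) ^+ k) ^+ 2.
have XT n : ((X n)%:E <= (2 / a)%:E * hmean c (contract r))%E.
  apply: le_trans (_ : ((2 / a)%:E * (\sum_(j < n) (normc (c j) * contract r ^+ j) ^+
    2)%:E <= _)%E).
    by rewrite -EFinM lee_fin schur_finite.
  by rewrite lee_pmul2l ?lte_fin ?divr_gt0 // hmean_partial.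
have Xc : X @ \oo --> \sum_(k < m) (normc (d k) * (a * r) ^+ k) ^+ 2.
  apply: (@cvg_sum_ord
    (fun k n => (normc (\sum_(j < n) rterm c (1 - a)%:C k j) * (a * r) ^+ k) ^+ 2)
    (fun k => (normc (d k) * (a * r) ^+ k) ^+ 2)) => k.
  apply: cvg_sqr; apply: cvgM; last exact: cvg_cst.
  exact: has_csum_cvg_mod.
have -> : \sum_(k < m) (normc (d k * a%:C ^+ k) * r ^+ k) ^+ 2 =
    \sum_(k < m) (normc (d k) * (a * r) ^+ k) ^+ 2.
  by apply: eq_bigr => k _; rewrite modM modX mod_real gtr0_norm // -mulrA -exprMn.
have XcE : (fun n => (X n)%:E) @ \oo -->
    ((\sum_(k < m) (normc (d k) * (a * r) ^+ k) ^+ 2)%:E : \bar R).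
  exact: cvg_EFin_seq.
rewrite -(cvg_lim _ XcE) //; apply: lime_le; first by apply/cvg_ex; eexists; exact: XcE.
exact: nearW.
Qed.

End Schur.

(** * Linear changes of variables in the plane *)

Section Substitution.
Variable R : realType.
Local Notation T := (measurableTypeR R).
Local Notation mu := (@lebesgue_measure R).
Local Notation mu2 := (mu \x mu)%E.
Implicit Types (al be : R).

Lemma measurable_affine al be :
  measurable_fun (setT : set T) (fun x : T => al * x + be : T).
Proof.
by apply: measurable_funD; [apply: measurable_funM|]; try exact: measurable_cst; exact:
  measurable_id.
Qed.

(** By uniqueness of Lebesgue measure, half-open intervals suffice. A negative slope turns them into
    intervals closed at the other end, hence the two cases. *)
Lemma lebesgue_measure_affine al be (A : set T) : al != 0 -> measurable A ->
  pushforward (mscale (NngNum (normr_ge0 al)) mu) (fun x : T => (al * x + be)%R : T) A =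
    mu A.
Proof.
move=> al0 mA; apply/esym/lebesgue_measure_unique; first exact: measurable_affine; last
  by [].
move=> mphi _ [[p q] _ <-]; rewrite /pushforward /mscale /=.
pose p' := (p - be) / al; pose q' := (q - be) / al.
have [al1|al1] := ltP 0 al.
  rewrite [X in (_ = _ * mu X)%E](_ : _ = `]p', q']%classic); last first.
    apply/seteqP; split => x /=; rewrite !in_itv /= /p' /q'.
      by rewrite ltr_pdivrMr // ler_pdivlMr // ltrBlDr lerBrDr mulrC.
    by rewrite ltr_pdivrMr // ler_pdivlMr // ltrBlDr lerBrDr mulrC.
  rewrite !lebesgue_measure_itv /= !lte_fin ltr_pM2r ?invr_gt0 // ltrD2r.
  case: ifPn => pq; last by rewrite mule0.
  by rewrite -!EFinB -EFinM gtr0_norm // /p' /q'; congr (_%:E); field.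
have {}al1 : al < 0 by rewrite lt_neqAle al0.
rewrite [X in (_ = _ * mu X)%E](_ : _ = `[q', p'[%classic); last first.
  apply/seteqP; split => x /=; rewrite !in_itv /= /p' /q'.
    by rewrite ltr_ndivlMr // ler_ndivrMr // ltrBlDr lerBrDr mulrC andbC.
  by rewrite ltr_ndivlMr // ler_ndivrMr // ltrBlDr lerBrDr mulrC andbC.
rewrite !lebesgue_measure_itv /= !lte_fin ltr_nM2r ?invr_lt0 // ltrD2r.
case: ifPn => pq; last by rewrite mule0.
by rewrite -!EFinB -EFinM ltr0_norm // /p' /q'; congr (_%:E); field.
Qed.

Lemma ge0_integral_affine al be (g : T -> \bar R) : al != 0 ->
  measurable_fun setT g -> (forall x, 0 <= g x)%E ->
  (\int[mu]_x g x = `|al|%:E * \int[mu]_x g (al * x + be)%R)%E.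
Proof.
move=> al0 mg g0; have mphi := measurable_affine al be.
transitivity (\int[pushforward (mscale (NngNum (normr_ge0 al)) mu)
    (fun x : T => (al * x + be)%R : T)]_x g x)%E.
  by apply: eq_measure_integral => // A mA _; exact/esym/lebesgue_measure_affine.
rewrite ge0_integral_pushforward //= preimage_setT ge0_integral_mscale //=.
exact: measurableT_comp mg mphi.
Qed.

Lemma measurable_linear2 (al be : R) :
  measurable_fun setT (fun p : T * T => (al * p.1 + be * p.2)%R : T).
Proof.
by apply: measurable_funD; apply: measurable_funM; try exact: measurable_cst;
  [exact: measurable_fst|exact: measurable_snd].
Qed.

Lemma measurable_on_pair d (U : measurableType d) (g : T * T -> \bar R) (u v : U -> T) :
  measurable_fun setT g -> measurable_fun setT u -> measurable_fun setT v ->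
  measurable_fun setT (fun p => g (u p, v p)).
Proof. by move=> mg mu' mv; apply: (measurableT_comp mg); exact: measurable_fun_pair. Qed.

Lemma tonelli12 (g : T * T -> \bar R) : measurable_fun setT g -> (forall x, 0 <= g x)%E ->
  (\int[mu2]_p g p = \int[mu]_x \int[mu]_y g (x, y))%E.
Proof. by move=> mg g0; rewrite fubini_tonelli1. Qed.

Lemma tonelli21 (g : T * T -> \bar R) : measurable_fun setT g -> (forall x, 0 <= g x)%E ->
  (\int[mu2]_p g p = \int[mu]_y \int[mu]_x g (x, y))%E.
Proof. by move=> mg g0; rewrite tonelli12 // fubini_tonelli. Qed.

Lemma ge0_integral_swap (g : T * T -> \bar R) :
  measurable_fun setT g -> (forall x, 0 <= g x)%E ->
  (\int[mu2]_p g p = \int[mu2]_p g (p.2, p.1))%E.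
Proof.
move=> mg g0; rewrite tonelli12 // tonelli21 //.
by apply: (measurableT_comp mg); apply: measurable_fun_pair; [exact:
  measurable_snd|exact: measurable_fst].
Qed.

Lemma ge0_integral_shear1 (al be : R) (g : T * T -> \bar R) : al != 0 ->
  measurable_fun setT g -> (forall x, 0 <= g x)%E ->
  (\int[mu2]_p g p = `|al|%:E * \int[mu2]_p g ((al * p.1 + be * p.2)%R, p.2))%E.
Proof.
move=> al0 mg g0.
have mg' : measurable_fun setT (fun p : T * T => g ((al * p.1 + be * p.2)%R, p.2)).
  apply: (measurableT_comp mg); apply: measurable_fun_pair; last exact: measurable_snd.
  exact: measurable_linear2.
rewrite tonelli21 // (tonelli21 mg') //=.
rewrite -ge0_integralZl //; last 2 first.
- exact: (measurable_fun_fubini_tonelli_G (m1 := mu) _ mg' (fun p => g0 _)).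
- by move=> y _; exact: integral_ge0.
apply: eq_integral => y _; apply: (@ge0_integral_affine al (be * y) (fun x => g (x, y)))
  => //.
exact: measurableT_comp mg (measurable_pair2 y).
Qed.

Lemma ge0_integral_shear2 (al be : R) (g : T * T -> \bar R) : al != 0 ->
  measurable_fun setT g -> (forall x, 0 <= g x)%E ->
  (\int[mu2]_p g p = `|al|%:E * \int[mu2]_p g (p.1, (al * p.2 + be * p.1)%R))%E.
Proof.
move=> al0 mg g0.
have mg1 : measurable_fun setT (fun p : T * T => g (p.2, p.1)).
  by apply: (measurableT_comp mg); apply: measurable_fun_pair; [exact:
    measurable_snd|exact: measurable_fst].
have mg2 : measurable_fun setT (fun p : T * T => g (p.1, (al * p.2 + be * p.1)%R)).
  apply: (measurableT_comp mg); apply: measurable_fun_pair; first exact: measurable_fst.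
  have := measurable_linear2 be al; congr (measurable_fun _ _).
  by apply/funext => p; rewrite addrC.
rewrite ge0_integral_swap // (@ge0_integral_shear1 al be) //=; congr (_ * _)%E.
by rewrite [RHS]ge0_integral_swap.
Qed.

(* A rotation is a product of two shears combined with scalings, so it is
   enough to substitute in one variable at a time. *)
Lemma ge0_integral_rotation (t : R) (g : T * T -> \bar R) :
  measurable_fun setT g -> (forall x, 0 <= g x)%E ->
  (\int[mu2]_p g p =
   \int[mu2]_p g ((cos t * p.1 - sin t * p.2)%R, (sin t * p.1 + cos t * p.2)%R))%E.
Proof.
move=> mg g0; set c := cos t; set s := sin t.
have cs : c ^+ 2 + s ^+ 2 = 1 by exact: cos2Dsin2.
(* The factorization into shears divides by [cos t]. When that vanishes, the rotation is an exchange
   of the coordinates up to sign. *)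
have [c0|c0] := eqVneq c 0.
  have s2 : s ^+ 2 = 1 by rewrite -cs c0 expr0n add0r.
  have s1 : `|s| = 1.
    by apply/eqP; rewrite -(eqrXn2 (n := 2)) // expr1n real_normK ?num_real // s2.
  have s0 : s != 0 by rewrite -normr_gt0 s1.
  have mg1 : measurable_fun setT (fun p : T * T => g ((- s * p.1 + 0 * p.2)%R, p.2)).
    apply: (measurableT_comp mg); apply: measurable_fun_pair; last exact: measurable_snd.
    exact: measurable_linear2.
  have mg2 : measurable_fun setT (fun p : T * T => g ((- s * p.1 + 0 * (s * p.2 + 0 *
    p.1))%R, (s * p.2 + 0 * p.1)%R)).
    apply: (measurable_on_pair (u := fst) (v := fun p => (s * p.2 + 0 * p.1)%R) mg1).
      exact: measurable_fst.
    have := measurable_linear2 0 s; congr (measurable_fun _ _).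
    by apply/funext => p; rewrite addrC.
  rewrite (@ge0_integral_shear1 (- s) 0) ?oppr_eq0 // normrN s1 mul1e.
  rewrite (@ge0_integral_shear2 s 0 (fun p => g ((- s * p.1 + 0 * p.2)%R, p.2))) // s1
    mul1e.
  rewrite ge0_integral_swap //=; apply: eq_integral => -[x y] _ /=.
  by rewrite c0 !mul0r !addr0 add0r mulNr.
have ci0 : c^-1 != 0 by rewrite invr_eq0.
have mg1 : measurable_fun setT (fun p : T * T => g (p.1, (c^-1 * p.2 + s / c * p.1)%R)).
  apply: (measurableT_comp mg); apply: measurable_fun_pair; first exact: measurable_fst.
  have := measurable_linear2 (s / c) c^-1; congr (measurable_fun _ _).
  by apply/funext => p; rewrite addrC.
rewrite (@ge0_integral_shear2 c^-1 (s / c)) //.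
rewrite (@ge0_integral_shear1 c (- s) (fun p => g (p.1, (c^-1 * p.2 + s / c * p.1)%R)))
  //=.
rewrite muleA -EFinM normfV mulVf ?normr_eq0 // mul1e.
apply: eq_integral => -[x y] _ /=; congr (g (_, _)); first by rewrite mulNr.
transitivity ((1 - s ^+ 2) / c * y + s * x); last first.
  by rewrite -cs addrK expr2 mulfK // addrC.
by field.
Qed.

Lemma integralT_oneDsqrV : (\int[mu]_x ((oneDsqr x)^-1)%:E = pi%:E)%E.
Proof.
rewrite ge0_symfun_integralT; last 3 first.
- by move=> x; rewrite invr_ge0.
- exact: continuous_oneDsqrV.
- by move=> x; rewrite /= /oneDsqr sqrrN.
by rewrite -set_itvcy integral0y_oneDsqr -EFinM; congr (_%:E); field.
Qed.

(* The substitution [y = x s] turns [x^2 + y^2] into [x^2 (1 + s^2)], and a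
   rescaling of [x] then separates the variables. *)
Lemma ge0_integral_radial (H : T -> \bar R) :
  measurable_fun setT H -> (forall x, 0 <= H x)%E ->
  (\int[mu2]_p H (p.1 ^+ 2 + p.2 ^+ 2)%R = pi%:E * \int[mu]_x (`|x|%:E * H (x ^+ 2)%R))%E.
Proof.
move=> mH H0.
have msq (U : T * T -> T) : measurable_fun setT U -> measurable_fun setT (fun p => U p
  ^+ 2 : T).
  by move=> mU; apply: measurable_funX.
have mabs : measurable_fun (setT : set T) (fun x : T => `|x|%:E).
  by apply/measurable_EFinP; exact: normr_measurable.
have mH1 : measurable_fun setT (fun p : T * T => H (p.1 ^+ 2 + p.2 ^+ 2)%R).
  apply: (measurableT_comp mH); apply: measurable_funD; apply: msq.
    exact: measurable_fst.
  exact: measurable_snd.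
have mH2 : measurable_fun setT (fun p : T * T => H (p.1 ^+ 2 * oneDsqr p.2)%R).
  apply: (measurableT_comp mH); apply: measurable_funM; first exact: msq measurable_fst.
  by apply: measurable_funD; [exact: measurable_cst|exact: msq measurable_snd].
pose L (p : T * T) := (`|p.1|%:E * H (p.1 ^+ 2 * oneDsqr p.2)%R)%E.
have mL : measurable_fun setT L.
  by apply: emeasurable_funM => //; exact: measurableT_comp mabs measurable_fst.
have L0 p : (0 <= L p)%E by rewrite mule_ge0 ?lee_fin.
have mK : measurable_fun setT (fun x : T => `|x|%:E * H (x ^+ 2)%R)%E.
  apply: emeasurable_funM => //; apply: (measurableT_comp mH).
  exact: measurable_funX.
set IK := (\int[mu]_x (`|x|%:E * H (x ^+ 2)%R))%E.
have K0 x : (0 <= `|x|%:E * H (x ^+ 2)%R)%E by rewrite mule_ge0 ?lee_fin.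
have IK0 : (0 <= IK)%E by exact: integral_ge0.
have secH2 (x : T) : measurable_fun setT (fun s : T => H (x ^+ 2 * oneDsqr s)%R).
  exact: (measurableT_comp mH2 (measurable_pair1 x)).
rewrite tonelli12 //.
transitivity (\int[mu]_x \int[mu]_s L (x, s))%E.
  apply: ge0_ae_eq_integral => //.
  - exact: (measurable_fun_fubini_tonelli_F (m2 := mu) _ mH1 (fun p => H0 _)).
  - exact: (measurable_fun_fubini_tonelli_F (m2 := mu) _ mL L0).
  - by move=> x _; exact: integral_ge0.
  - by move=> x _; exact: integral_ge0.
  (* The substitution [y = x s] breaks down only at [x = 0], a null set. *)
  exists [set 0]; split => //; first exact: lebesgue_measure_set1.
  move=> x /= /not_implyP[_ h]; apply: contrapT => /eqP x0; apply: h.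
  rewrite /L /= ge0_integralZl //.
  rewrite (@ge0_integral_affine x 0 (fun y => H (x ^+ 2 + y ^+ 2)%R)) //.
    by congr (_ * _)%E; apply: eq_integral => s _; congr H; rewrite /oneDsqr; ring.
  exact: (measurableT_comp mH1 (measurable_pair1 x)).
rewrite (fubini_tonelli L) //.
transitivity (\int[mu]_s (((oneDsqr s)^-1)%:E * IK))%E; last first.
  rewrite ge0_integralZr //.
  - by rewrite integralT_oneDsqrV.
  - by apply/measurable_EFinP; apply: continuous_measurable_fun; exact:
    continuous_oneDsqrV.
apply: eq_integral => s _.
set A := Num.sqrt (oneDsqr s).
have A0 : 0 < A by rewrite sqrtr_gt0 (lt_le_trans ltr01 (oneDsqr_ge1 s)).
have A2 : A ^+ 2 = oneDsqr s by rewrite sqr_sqrtr // ltW // (lt_le_trans ltr01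
  (oneDsqr_ge1 s)).
have mLs : measurable_fun setT (fun x : T => L (x, s)).
  exact: (measurableT_comp mL (measurable_pair2 s)).
(* Rescaling by [A] produces one factor [A] from the measure and another from the absolute value,
   together [oneDsqr s]. *)
have -> : IK = ((oneDsqr s)%:E * \int[mu]_x L (x, s))%E.
  rewrite /IK (@ge0_integral_affine A 0 (fun x => `|x|%:E * H (x ^+ 2)%R)%E) //; last by
    rewrite gt_eqF.
  rewrite gtr0_norm // -A2 expr2 EFinM -muleA; congr (_ * _)%E.
  rewrite -ge0_integralZl //; last by rewrite lee_fin ltW.
  apply: eq_integral => x _; rewrite /L /= addr0 normrM gtr0_norm // EFinM -muleA; congr
    (_ * (_ * H _))%E.
  by rewrite -A2; ring.
by rewrite muleA -EFinM mulVf ?mul1e // gt_eqF // (lt_le_trans ltr01 (oneDsqr_ge1 s)).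
Qed.

End Substitution.

(** * Hardy and Bergman norms of a power series *)

Section Norms.
Variable R : realType.
Local Notation C := (Cplx R).
Local Notation T := (measurableTypeR R).
Local Notation mu := (@lebesgue_measure R).
Local Notation mu2 := (mu \x mu)%E.
Implicit Types (c : nat -> C) (f : disk R -> C) (r : R).

Lemma ext0_csum f c (z : C) : has_coefs f c -> normc z < 1 ->
  has_csum (fun n => c n * z ^+ n) (ext0 f z).
Proof.
move=> hf z1; have := hf (exist _ z z1); rewrite -(ext0E f).
by [].
Qed.

Lemma ext0_out f (z : C) : 1 <= normc z -> ext0 f z = 0.
Proof. by move=> z1; rewrite /ext0 insubF // ltNge z1. Qed.

Lemma integral_circle f c (z : C) : has_coefs f c -> normc z < 1 ->
  (\int[mu]_(t in `[0%R, (2 * pi)%R]) (normc (ext0 f (cis t * z)) ^+ 2)%:E =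
   (2 * pi)%:E * hmean c (normc z))%E.
Proof.
move=> hf z1; have [M hM] := radge_abs_bdd (has_coefs_radge hf) z1.
rewrite (parseval hM (g := fun t => ext0 f (cis t * z))); last first.
  move=> t; have tz : normc (cis t * z) < 1 by rewrite modM mod_cis mul1r.
  apply: has_csum_eq (ext0_csum hf tz) => n.
  by rewrite exprMn mulrA mulrAC.
by congr (_ * _)%E; apply: eq_eseriesr => n _; rewrite modM modX.
Qed.

Lemma circle_mean_hmean f c r : has_coefs f c -> 0 <= r < 1 ->
  circle_mean f r = hmean c r.
Proof.
move=> hf /andP[r0 r1]; rewrite /circle_mean.
have rC : normc (r%:C : C) = r by rewrite mod_real ger0_norm.
have := @integral_circle f c r%:C hf; rewrite rC => /(_ r1) e.
have -> : (\int[mu]_(t in `[0%R, (2 * pi)%R])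
    (normc (ext0 f ((r * cos t) +i* (r * sin t))) ^+ 2)%:E)%E =
    (\int[mu]_(t in `[0%R, (2 * pi)%R]) (normc (ext0 f (cis t * r%:C)) ^+ 2)%:E)%E.
  apply: eq_integral => t _; congr (normc (ext0 f _) ^+ 2)%:E.
  by apply/eqP; rewrite eq_complex /=; apply/andP; split; apply/eqP; ring.
have pi2 : 2 * pi != 0 :> R by rewrite gt_eqF // mulr_gt0 // pi_gt0.
by rewrite e muleA -EFinM mulVf // mul1e.
Qed.

Lemma hardy_sqnorm_hmean f c : has_coefs f c ->
  hardy_sqnorm f = ereal_sup [set hmean c r | r in `]0, 1[%classic].
Proof.
move=> hf; congr ereal_sup; apply/seteqP; split => _ [r /= + <-]; rewrite in_itv /= =>
  /andP[r0 r1].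
  by exists r; rewrite /= ?in_itv /= ?r0 // (circle_mean_hmean hf) // ltW.
by exists r; rewrite /= ?in_itv /= ?r0 // (circle_mean_hmean hf) // ltW.
Qed.

Definition cplx_of (p : T * T) : C := p.1 +i* p.2.

Lemma measurable_normc d (U : measurableType d) (u v : U -> T) :
  measurable_fun setT u -> measurable_fun setT v ->
  measurable_fun setT (fun x => normc (u x +i* v x) : T).
Proof.
move=> hu hv; rewrite /normc; apply: (measurableT_comp (f := Num.sqrt : T -> T)).
  by apply: continuous_measurable_fun; exact: sqrt_continuous.
by apply: measurable_funD; exact: measurable_funX.
Qed.

Definition cmeasurable d (U : measurableType d) (h : U -> C) :=
  measurable_fun setT (fun x => re (h x) : T) /\ measurable_fun setT (fun x => im (h x)
    : T).

Lemma cmeasurable_mod d (U : measurableType d) (h : U -> C) :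
  cmeasurable h -> measurable_fun setT (fun x => normc (h x) : T).
Proof.
move=> [h1 h2]; have := measurable_normc h1 h2; congr (measurable_fun _ _).
by apply/funext => x; case: (h x).
Qed.

Lemma cmeasurableM d (U : measurableType d) (h k : U -> C) :
  cmeasurable h -> cmeasurable k -> cmeasurable (fun x => h x * k x).
Proof.
move=> [h1 h2] [k1 k2]; split.
  rewrite (_ : (fun x => _) = (fun x => re (h x) * re (k x) - im (h x) * im (k x))).
    by apply: measurable_funB; exact: measurable_funM.
  by apply/funext => x; case: (h x) (k x) => ? ? [].
rewrite (_ : (fun x => _) = (fun x => re (h x) * im (k x) + im (h x) * re (k x))).
  by apply: measurable_funD; exact: measurable_funM.
by apply/funext => x; case: (h x) (k x) => ? ? [].
Qed.

Lemma cmeasurable_cst d (U : measurableType d) (z : C) : cmeasurable (fun _ : U => z).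
Proof. by split; exact: measurable_cst. Qed.

Lemma cmeasurableX d (U : measurableType d) (h : U -> C) n :
  cmeasurable h -> cmeasurable (fun x => h x ^+ n).
Proof.
move=> hh; elim: n => [|n IH].
  rewrite (_ : (fun x => _) = fun=> 1); first exact: cmeasurable_cst.
  by apply/funext => x; rewrite expr0.
rewrite (_ : (fun x => _) = fun x => h x * h x ^+ n); first exact: cmeasurableM.
by apply/funext => x; rewrite exprS.
Qed.

Lemma cmeasurable_sum d (U : measurableType d) (h : nat -> U -> C) n :
  (forall k, cmeasurable (h k)) -> cmeasurable (fun x => \sum_(k < n) h k x).
Proof.
move=> hh; elim: n => [|n [IH1 IH2]].
  rewrite (_ : (fun x => _) = fun=> 0); first exact: cmeasurable_cst.
  by apply/funext => x; rewrite big_ord0.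
have [h1 h2] := hh n; split.
  rewrite (_ : (fun x => _) = (fun x => re (\sum_(k < n) h k x) + re (h n x))).
    exact: measurable_funD.
  by apply/funext => x; rewrite big_ord_recr /=; case: (\sum_(k < n) h k x) (h n x) => ?
    ? [].
rewrite (_ : (fun x => _) = (fun x => im (\sum_(k < n) h k x) + im (h n x))).
  exact: measurable_funD.
by apply/funext => x; rewrite big_ord_recr /=; case: (\sum_(k < n) h k x) (h n x) => ? ?
  [].
Qed.

Lemma measurable_ext0 d (U : measurableType d) f c (h : U -> C) :
  has_coefs f c -> cmeasurable h ->
  measurable_fun setT (fun x => (normc (ext0 f (h x)) ^+ 2)%:E).
Proof.
move=> hf hh.
(* The cut-off makes the approximants converge everywhere: off the disk the series may diverge,
   while [ext0 f] is zero. *)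
pose F n x : \bar R := (if normc (h x) < 1 then normc (\sum_(k < n) c k * h x ^+ k) ^+ 2
  else 0)%:E.
apply: (emeasurable_fun_cvg F) => [n|x _].
  apply/measurable_EFinP; apply: measurable_fun_ifT.
  - by apply: measurable_fun_ltr; [exact: cmeasurable_mod|exact: measurable_cst].
  - apply: measurable_funX; apply: cmeasurable_mod; apply: (cmeasurable_sum (h := fun k
    x => c k * h x ^+ k)) => k.
    by apply: cmeasurableM; [exact: cmeasurable_cst|exact: cmeasurableX].
  - exact: measurable_cst.
rewrite /F; case: (ltP (normc (h x)) 1) => hx.
  exact: cvg_EFin_seq (cvg_sqr (has_csum_cvg_mod (ext0_csum hf hx))).
by rewrite ext0_out // mod0 expr0n; exact: cvg_cst.
Qed.

Lemma measurable_hmean c : measurable_fun (setT : set T) (hmean c).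
Proof.
apply: ge0_emeasurable_sum => [k x _ _|k _]; first by rewrite lee_fin sqr_ge0.
apply/measurable_EFinP; apply: measurable_funX; apply: measurable_funM; first exact:
  measurable_cst.
exact: measurable_funX.
Qed.

End Norms.
Arguments cplx_of {R} p.

(** * Reduction of the Bergman norm to a radial integral *)

Section Bergman.
Variable R : realType.
Local Notation C := (Cplx R).
Local Notation T := (measurableTypeR R).
Local Notation mu := (@lebesgue_measure R).
Local Notation mu2 := (mu \x mu)%E.
Implicit Types (c : nat -> C) (f : disk R -> C) (r : R).
Variable b : R.
Hypothesis b1 : -1 < b.

Definition disk_weight (p : T * T) : R :=
  if normc (cplx_of p) < 1 then bergman_weight b (cplx_of p) else 0.

Lemma bergman_weight_ge0 (z : C) : 0 <= bergman_weight b z.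
Proof.
rewrite /bergman_weight !mulr_ge0 ?powR_ge0 ?invr_ge0 ?pi_ge0 //.
by move: b1; lra.
Qed.

Lemma disk_weight_ge0 p : 0 <= disk_weight p.
Proof. by rewrite /disk_weight; case: ifP => // _; exact: bergman_weight_ge0. Qed.

Lemma cmeasurable_cplx_of : cmeasurable (@cplx_of R).
Proof. by split; [exact: measurable_fst|exact: measurable_snd]. Qed.

Lemma measurable_disk_weight : measurable_fun setT (disk_weight : T * T -> T).
Proof.
have mn := cmeasurable_mod cmeasurable_cplx_of.
apply: measurable_fun_ifT.
- by apply: (measurable_fun_ltr mn); exact: measurable_cst.
- apply: measurable_funM; first exact: measurable_cst.
  apply: (measurableT_comp (f := (fun x : R => x `^ b) : T -> T)); first exact:
    measurable_powR.
  by apply: measurable_funB; [exact: measurable_cst|exact: measurable_funX].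
- exact: measurable_cst.
Qed.

(** Extended evenly to the whole line: this absorbs the factor 2 of the polar formula and allows
    affine substitutions without boundary terms. The factor [pi] of the polar formula has cancelled
    the normalization of area. *)
Definition radial_weight (x : R) : R :=
  if `|x| < 1 then (b + 1) * `|x| * (1 - x ^+ 2) `^ b else 0.

Lemma radial_weight_ge0 x : 0 <= radial_weight x.
Proof.
rewrite /radial_weight; case: ifP => // _; rewrite !mulr_ge0 ?powR_ge0 //.
by move: b1; lra.
Qed.

Lemma measurable_radial_weight : measurable_fun (setT : set T) (radial_weight : T -> T).
Proof.
have mn : measurable_fun (setT : set T) (fun x : T => `|x| : T) by exact:
  normr_measurable.
apply: measurable_fun_ifT.
- by apply: (measurable_fun_ltr mn); exact: measurable_cst.
- apply: measurable_funM; first by apply: measurable_funM => //; exact: measurable_cst.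
  apply: (measurableT_comp (f := (fun x : R => x `^ b) : T -> T)); first exact:
    measurable_powR.
  by apply: measurable_funB; [exact: measurable_cst|exact: measurable_funX].
- exact: measurable_cst.
Qed.

Lemma bergman_sqnormE f : bergman_sqnorm b f =
  (\int[mu2]_p (normc (ext0 f (cplx_of p)) ^+ 2 * disk_weight p)%:E)%E.
Proof.
rewrite /bergman_sqnorm integral_mkcond; apply: eq_integral => p _.
rewrite patchE /disk_weight /cplx_of; case: ifPn => hp.
  by move: hp; rewrite inE /= => ->.
by case: ifPn => hp'; [move/negP: hp; rewrite inE /= |rewrite mulr0].
Qed.

Lemma tonelli3 (g : T * (T * T) -> \bar R) :
  measurable_fun setT g -> (forall x, 0 <= g x)%E ->
  (\int[mu]_t \int[mu2]_p g (t, p) = \int[mu2]_p \int[mu]_t g (t, p))%E.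
Proof.
move=> mg g0.
have mg1 : measurable_fun setT (fun q : (T * T) * T => g (q.1.1, (q.1.2, q.2))).
  apply: (measurableT_comp mg); apply: measurable_fun_pair.
    exact: (measurableT_comp measurable_fst measurable_fst).
  apply: measurable_fun_pair; last exact: measurable_snd.
  exact: (measurableT_comp measurable_snd measurable_fst).
have mh : measurable_fun setT (fun q : T * T => \int[mu]_y g (q.1, (q.2, y)))%E.
  exact: (measurable_fun_fubini_tonelli_F (m2 := mu) _ mg1 (fun q => g0 _)).
have mk : measurable_fun setT (fun p : T * T => \int[mu]_t g (t, p))%E.
  exact: (measurable_fun_fubini_tonelli_G (m1 := mu) _ mg g0).
transitivity (\int[mu]_t \int[mu]_x \int[mu]_y g (t, (x, y)))%E.
  apply: eq_integral => t _; apply: (tonelli12 (g := fun p => g (t, p))) => //.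
  exact: (measurableT_comp mg (measurable_pair1 t)).
transitivity (\int[mu]_x \int[mu]_t \int[mu]_y g (t, (x, y)))%E.
  apply: (fubini_tonelli (m1 := mu) (m2 := mu) (fun q : T * T => \int[mu]_y g (q.1,
    (q.2, y)))%E mh) => q.
  exact: integral_ge0.
rewrite (tonelli12 mk); last by move=> p; exact: integral_ge0.
apply: eq_integral => x _.
apply: (fubini_tonelli (m1 := mu) (m2 := mu) (fun q : T * T => g (q.1, (x, q.2)))) => //.
apply: (measurableT_comp mg); apply: measurable_fun_pair; first exact: measurable_fst.
by apply: measurable_fun_pair; [exact: measurable_cst|exact: measurable_snd].
Qed.

(* Averaging over all rotations replaces [|f|^2] by its circular means. *)
Lemma bergman_sqnorm_disk f c : has_coefs f c -> bergman_sqnorm b f =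
  (\int[mu2]_p ((disk_weight p)%:E * hmean c (normc (cplx_of p))))%E.
Proof.
move=> hf; rewrite bergman_sqnormE.
pose G (p : T * T) := (normc (ext0 f (cplx_of p)) ^+ 2 * disk_weight p)%:E.
pose rot (tp : T * (T * T)) : T * T :=
  (cos tp.1 * tp.2.1 - sin tp.1 * tp.2.2, sin tp.1 * tp.2.1 + cos tp.1 * tp.2.2).
have G0 p : (0 <= G p)%E by rewrite lee_fin mulr_ge0 ?sqr_ge0 ?disk_weight_ge0.
have mG : measurable_fun setT G.
  rewrite (_ : G = fun p => ((normc (ext0 f (cplx_of p)) ^+ 2)%:E * (disk_weight
    p)%:E)%E).
    apply: emeasurable_funM; first exact: measurable_ext0 hf cmeasurable_cplx_of.
    by apply/measurable_EFinP; exact: measurable_disk_weight.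
  by apply/funext => p; rewrite EFinM.
have mcos : measurable_fun setT (fun tp : T * (T * T) => cos tp.1 : T).
  apply: (measurableT_comp (f := cos : T -> T)); last exact: measurable_fst.
  by apply: continuous_measurable_fun; exact: continuous_cos.
have msin : measurable_fun setT (fun tp : T * (T * T) => sin tp.1 : T).
  apply: (measurableT_comp (f := sin : T -> T)); last exact: measurable_fst.
  by apply: continuous_measurable_fun; exact: continuous_sin.
have m1 : measurable_fun setT (fun tp : T * (T * T) => tp.2.1 : T).
  exact: (measurableT_comp measurable_fst measurable_snd).
have m2 : measurable_fun setT (fun tp : T * (T * T) => tp.2.2 : T).
  exact: (measurableT_comp measurable_snd measurable_snd).
have mrot : measurable_fun setT rot.
  apply: measurable_fun_pair.
    by apply: measurable_funB; exact: measurable_funM.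
  by apply: measurable_funD; exact: measurable_funM.
pose A : set T := `[0, 2 * pi]%classic.
have mA : measurable A by exact: measurable_itv.
pose g (tp : T * (T * T)) := (G (rot tp) * (\1_A tp.1)%:E)%E.
have mg : measurable_fun setT g.
  apply: emeasurable_funM; first exact: measurableT_comp mG mrot.
  apply/measurable_EFinP; apply: (measurableT_comp (f := \1_A : T -> T)); last exact:
    measurable_fst.
  exact: measurable_indic.
have g0 tp : (0 <= g tp)%E by rewrite mule_ge0 // lee_fin.
have pi2 : 0 < 2 * pi :> R by rewrite mulr_gt0 // pi_gt0.
have lA : mu A = (2 * pi)%:E by rewrite lebesgue_measure_itv /= lte_fin pi2 oppr0 adde0.
pose X := (\int[mu2]_p G p)%E; rewrite -[LHS]/X.
have X0 : (0 <= X)%E by apply: integral_ge0 => p _; exact: G0.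
have rotT t : measurable_fun setT (fun p => rot (t, p)).
  exact: (measurableT_comp mrot (measurable_pair1 t)).
have e1 : ((2 * pi)%:E * X = \int[mu]_t \int[mu2]_p g (t, p))%E.
  transitivity (\int[mu]_t (X * (\1_A t)%:E))%E.
    rewrite ge0_integralZl //; last by apply/measurable_EFinP; exact: measurable_indic.
    by rewrite integral_indic // setIT [RHS]muleC; congr (_ * _)%E; exact: esym lA.
  apply: eq_integral => t _.
  transitivity ((\int[mu2]_p G (rot (t, p))) * (\1_A t)%:E)%E.
    have -> : X = (\int[mu2]_p G (rot (t, p)))%E by exact: (ge0_integral_rotation t mG
      G0).
    by [].
  symmetry; rewrite -[LHS]/(\int[mu2]_p (G (rot (t, p)) * (\1_A t)%:E))%E.
  apply: (@ge0_integralZr _ _ _ mu2 setT measurableT (fun p => G (rot (t, p)))).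
  - exact: measurableT_comp mG (rotT t).
  - by move=> p _; exact: G0.
  - by rewrite lee_fin.
have swap : (\int[mu]_t \int[mu2]_p g (t, p) = \int[mu2]_p \int[mu]_t g (t, p))%E.
  exact: tonelli3.
pose W (p : T * T) := ((disk_weight p)%:E * hmean c (normc (cplx_of p)))%E.
have mW : measurable_fun setT W.
  apply: emeasurable_funM; first by apply/measurable_EFinP; exact: measurable_disk_weight.
  exact: measurableT_comp (measurable_hmean c) (cmeasurable_mod cmeasurable_cplx_of).
have W0 p : (0 <= W p)%E by rewrite mule_ge0 ?lee_fin ?disk_weight_ge0 ?hmean_ge0.
have pi2E : (0 <= (2 * pi)%:E :> \bar R)%E by rewrite lee_fin ltW.
have e2 : ((2 * pi)%:E * X = (2 * pi)%:E * \int[mu2]_p W p)%E.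
  rewrite e1 swap; symmetry.
  have <- := @ge0_integralZl _ _ _ mu2 setT measurableT W mW (2 * pi)%:E (fun p _ => W0
    p) pi2E.
  symmetry; apply: eq_integral => p _.
  transitivity (\int[mu]_(t in A) G (rot (t, p)))%E.
    by rewrite [RHS]integral_mkcond epatch_indic.
  have rotE t : cplx_of (rot (t, p)) = cis t * cplx_of p.
    by rewrite /cplx_of /rot /cis; apply/eqP; rewrite eq_complex /= eqxx addrC eqxx.
  have rotm t : normc (cplx_of (rot (t, p))) = normc (cplx_of p).
    by rewrite rotE modM mod_cis mul1r.
  have wE t : disk_weight (rot (t, p)) = disk_weight p.
    by rewrite /disk_weight rotm /bergman_weight rotm.
  have [hp|hp] := ltP (normc (cplx_of p)) 1; last first.
    rewrite /W /disk_weight ltNge hp /= mul0e mule0; apply: integral0_eq => t _.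
    by rewrite /G wE /disk_weight ltNge hp /= mulr0.
  rewrite /W muleCA -(integral_circle hf hp).
  have mc : cmeasurable (fun t : T => cis t * cplx_of p).
    apply: cmeasurableM; last exact: cmeasurable_cst.
    by split; apply: continuous_measurable_fun; [exact: continuous_cos|exact:
      continuous_sin].
  have mE : measurable_fun A (fun t : T => (normc (ext0 f (cis t * cplx_of p)) ^+ 2)%:E).
    exact: measurable_funS measurableT (@subsetT _ _) (measurable_ext0 hf mc).
  have w0 : (0 <= (disk_weight p)%:E)%E by rewrite lee_fin disk_weight_ge0.
  have E0 (t : T) : A t -> (0 <= (normc (ext0 f (cis t * cplx_of p)) ^+ 2)%:E)%E.
    by rewrite lee_fin sqr_ge0.
  have <- := @ge0_integralZl _ _ _ mu A mA _ mE (disk_weight p)%:E E0 w0.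
  by apply: eq_integral => t _; rewrite /G rotE wE EFinM muleC.
have pi2' : (2 * pi) != 0 :> R by rewrite gt_eqF.
have := congr1 (fun x => ((2 * pi)^-1%:E * x)%E) e2.
by rewrite !muleA -EFinM mulVf // !mul1e.
Qed.
Lemma bergman_sqnorm_radial f c : has_coefs f c -> bergman_sqnorm b f =
  (\int[mu]_x ((radial_weight x)%:E * hmean c `|x|))%E.
Proof.
move=> hf; rewrite (bergman_sqnorm_disk hf).
(* The variable [t] is the squared modulus, as [ge0_integral_radial] requires; this is why [H]
   evaluates [hmean c] at [Num.sqrt t]. *)
pose w (t : R) : R := if t < 1 then pi^-1 * (b + 1) * (1 - t) `^ b else 0.
have w0 t : 0 <= w t.
  rewrite /w; case: ifP => // _; rewrite !mulr_ge0 ?powR_ge0 ?invr_ge0 ?pi_ge0 //.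
  by move: b1; lra.
have mw : measurable_fun (setT : set T) (w : T -> T).
  apply: measurable_fun_ifT.
  - by apply: measurable_fun_ltr; [exact: measurable_id|exact: measurable_cst].
  - apply: measurable_funM; first exact: measurable_cst.
    apply: (measurableT_comp (f := (fun x : R => x `^ b) : T -> T)); first exact:
      measurable_powR.
    by apply: measurable_funB; [exact: measurable_cst|exact: measurable_id].
  - exact: measurable_cst.
pose H (t : T) : \bar R := ((w t)%:E * hmean c (Num.sqrt t))%E.
have mH : measurable_fun setT H.
  apply: emeasurable_funM; first exact/measurable_EFinP.
  apply: (measurableT_comp (measurable_hmean c) (f := hmean c) (g := Num.sqrt : T -> T)).
  by apply: continuous_measurable_fun; exact: sqrt_continuous.
have H0 t : (0 <= H t)%E by rewrite mule_ge0 ?lee_fin ?hmean_ge0.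
transitivity (\int[mu2]_p H (p.1 ^+ 2 + p.2 ^+ 2)%R)%E.
  apply: eq_integral => p _; rewrite /H; congr ((_ : R)%:E * _)%E.
  rewrite /disk_weight /w /bergman_weight /cplx_of sqr_mod /=.
  by rewrite -{1}sqrtr1 ltr_sqrt.
rewrite (ge0_integral_radial mH H0).
have mK : measurable_fun setT (fun x : T => (`|x|%:E * H (x ^+ 2)%R)%E).
  apply: emeasurable_funM; first by apply/measurable_EFinP; exact: normr_measurable.
  by apply: (measurableT_comp mH); exact: measurable_funX.
have K0 (x : T) : (0 <= `|x|%:E * H (x ^+ 2)%R)%E by rewrite mule_ge0 ?lee_fin.
have p0 : (0 <= pi%:E :> \bar R)%E by rewrite lee_fin pi_ge0.
have <- := @ge0_integralZl _ _ _ mu setT measurableT _ mK pi%:E (fun x _ => K0 x) p0.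
apply: eq_integral => x _; rewrite /H sqrtr_sqr !muleA -!EFinM; congr ((_ : R)%:E * _)%E.
rewrite /w /radial_weight.
have -> : (x ^+ 2 < 1) = (`|x| < 1).
  by rewrite -(ltr_pXn2r (n := 2) _ (x := `|x|)) ?nnegrE // expr1n real_normK ?num_real.
case: ifP => _; last by rewrite mulr0.
have pi0 : pi != 0 :> R by rewrite gt_eqF // pi_gt0.
by move: pi0; generalize (@pi R) => P P0; field.
Qed.

End Bergman.

(** * The radial weight: change of variable and total mass *)

Section Radial.
Variable R : realType.
Local Notation C := (Cplx R).
Local Notation T := (measurableTypeR R).
Local Notation mu := (@lebesgue_measure R).
Variables (a b : R).
Hypothesis ha : 0 < a < 1.
Hypothesis b1 : -1 < b.
Local Notation wt := (radial_weight b).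

(** The ratio [q] of [1 - x ^+ 2] to [1 - y ^+ 2] lies between 1 and [2 / a]. Its power [b] is
    therefore at most 1 for negative [b] and at most that power of [2 / a] otherwise; the maximum
    covers both signs. *)
Lemma radial_weight_contract x : 0 < x < 1 ->
  wt x <= Num.max 1 ((2 / a) `^ b) * wt (contract a x).
Proof.
have /andP[a0 a1] := ha; move=> /andP[x0 x1].
set y := contract a x; have xy : x <= y by rewrite /y /contract; nra.
have y1 : y < 1 by rewrite /y /contract; nra.
have y0 : 0 < y by exact: lt_le_trans xy.
have yE : 1 - y = a / 2 * (1 - x) by rewrite /y /contract; ring.
rewrite /radial_weight !gtr0_norm // x1 y1.
have b0 : 0 < b + 1 by move: b1; lra.
pose q := 2 / a * ((1 + x) / (1 + y)).
have y1' : 0 < 1 + y by lra.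
have qE : 1 - x ^+ 2 = q * (1 - y ^+ 2).
  have -> : 1 - y ^+ 2 = (1 - y) * (1 + y) by ring.
  rewrite yE /q; field; by rewrite !gt_eqF.
have q1 : 1 <= q.
  rewrite /q mulrA ler_pdivlMr // mul1r mulrAC ler_pdivlMr //.
  nra.
have q2 : q <= 2 / a.
  rewrite /q -[X in _ <= X]mulr1 ler_wpM2l ?divr_ge0 ?(ltW a0) // ler_pdivrMr // mul1r.
  by rewrite lerD2l.
have qb : q `^ b <= Num.max 1 ((2 / a) `^ b).
  rewrite le_max; case: (leP 0 b) => hb.
    apply/orP; right; apply: ge0_ler_powR => //; rewrite ?nnegrE ?divr_ge0 ?(ltW a0) //.
    exact: le_trans q1.
  by apply/orP; left; rewrite -(powRr0 q); apply: ler_powR => //; exact: ltW.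
have yy : 0 <= 1 - y ^+ 2 by rewrite subr_ge0 expr_le1 // ltW.
rewrite qE powRM //; last by exact: le_trans q1.
have h : x * q `^ b <= y * Num.max 1 ((2 / a) `^ b).
  by apply: ler_pM => //; [exact: ltW|exact: powR_ge0].
have Y0 : 0 <= (b + 1) * (1 - y ^+ 2) `^ b by rewrite mulr_ge0 ?powR_ge0 // ltW.
have := ler_wpM2l Y0 h; congr (_ <= _); ring.
Qed.

Lemma ge0_integral_even (E : T -> \bar R) : measurable_fun setT E ->
  (forall x, 0 <= E x)%E -> (forall x, E (- x)%R = E x) -> E 0 = 0%E ->
  (\int[mu]_x E x = 2%:E * \int[mu]_x (if (0 < x)%R then E x else 0))%E.
Proof.
move=> mE E0 EN E00; pose Ep (x : T) := if 0 < x then E x else 0%E.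
have mEp : measurable_fun setT Ep.
  apply: measurable_fun_ifT => //.
  exact: (measurable_fun_ltr (f := fun _ : T => 0 : T) (g := fun x : T => x : T)).
have Ep0 x : (0 <= Ep x)%E by rewrite /Ep; case: ifP.
have mEpN : measurable_fun setT (fun x : T => Ep (-1 * x + 0)).
  exact: (measurableT_comp mEp (measurable_affine (-1) 0)).
have EE x : E x = (Ep x + Ep (-1 * x + 0)%R)%E.
  rewrite /Ep addr0 mulN1r oppr_gt0.
  by case: (ltgtP x 0) => [||->]; rewrite ?add0e ?adde0.
transitivity (\int[mu]_x (Ep x + Ep (-1 * x + 0)%R))%E.
  by apply: eq_integral => x _; rewrite EE.
rewrite ge0_integralD // -/(\int[mu]_x Ep x)%E.
rewrite (@ge0_integral_affine _ (-1) 0 Ep) // ?oppr_eq0 ?oner_eq0 //.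
by rewrite normrN1 mul1e mule_natl mule2n.
Qed.

(** The factors come, in order, from restricting to a half-line, from comparing the weights, and
    from the Jacobian of [contract]. *)
Definition radial_const : R := 2 * (Num.max 1 ((2 / a) `^ b) * (2 / a)).

Lemma radial_compare (h : T -> \bar R) : measurable_fun setT h -> (forall x, 0 <= h x)%E
  ->
  (\int[mu]_x ((wt x)%:E * h (contract a `|x|%R)) <=
   radial_const%:E * \int[mu]_x ((wt x)%:E * h `|x|%R))%E.
Proof.
move=> mh h0; have /andP[a0 a1] := ha.
have mabs : measurable_fun (setT : set T) (fun x : T => `|x| : T) by exact:
  normr_measurable.
have mwt : measurable_fun (setT : set T) (fun x => (wt x)%:E).
  by apply/measurable_EFinP; exact: measurable_radial_weight.
have w0 x : (0 <= (wt x)%:E)%E by rewrite lee_fin radial_weight_ge0.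
have mcontract : measurable_fun (setT : set T) (fun x : T => contract a `|x| : T).
  apply: measurable_funB; first exact: measurable_cst.
  apply: measurable_funM; first exact: measurable_cst.
  by apply: measurable_funB; first exact: measurable_cst.
pose E (x : T) := ((wt x)%:E * h (contract a `|x|%R))%E.
pose Ep (x : T) := if 0 < x then E x else 0%E.
pose K (y : T) := ((wt y)%:E * h `|y|%R)%E.
have mE : measurable_fun setT E.
  by apply: emeasurable_funM => //; exact: measurableT_comp mh mcontract.
have mEp : measurable_fun setT Ep.
  apply: measurable_fun_ifT => //.
  exact: (measurable_fun_ltr (f := fun _ : T => 0 : T) (g := fun x : T => x : T)).
have mK : measurable_fun setT K.
  by apply: emeasurable_funM => //; exact: measurableT_comp mh mabs.
have E0 x : (0 <= E x)%E by rewrite mule_ge0.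
have Ep0 x : (0 <= Ep x)%E by rewrite /Ep; case: ifP.
have K0 x : (0 <= K x)%E by rewrite mule_ge0.
pose C1 : R := Num.max 1 ((2 / a) `^ b).
have C10 : 0 <= C1 by rewrite le_max ler01.
(* Because of the absolute value, the substitution is affine only for positive [x]. Once restricted
   there, [Ep] is bounded on the whole line by a multiple of the nonnegative [K] composed with one
   affine map. *)
have -> : (\int[mu]_x E x = 2%:E * \int[mu]_x Ep x)%E.
  apply: ge0_integral_even => // [x|]; rewrite /E.
    by rewrite normrN /radial_weight normrN sqrrN.
  by rewrite /radial_weight normr0 mulr0 mul0r; case: ifP => _; rewrite mul0e.
rewrite /radial_const EFinM -muleA lee_pmul2l //.
apply: le_trans (_ : (\int[mu]_x (C1%:E * K (a / 2 * x + (1 - a / 2))%R) <= _)%E).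
  apply: ge0_le_integral => //.
  - apply: emeasurable_funM; first exact: measurable_cst.
    exact: (measurableT_comp mK (measurable_affine (a / 2) (1 - a / 2))).
  move=> x _; rewrite /Ep; case: ifP => x0; last by rewrite mule_ge0.
  have -> : a / 2 * x + (1 - a / 2) = contract a x by rewrite /contract; ring.
  case: (ltP x 1) => x1; last first.
    by rewrite /E /radial_weight gtr0_norm // ltNge x1 /= mul0e mule_ge0.
  have cx : 0 < contract a x by rewrite /contract; nra.
  rewrite /E /K !gtr0_norm // muleA -EFinM lee_wpmul2r // lee_fin.
  by apply: radial_weight_contract; rewrite x0.
have a2 : 0 < a / 2 by rewrite divr_gt0.
have mK' : measurable_fun setT (fun x : T => K (a / 2 * x + (1 - a / 2))).
  exact: (measurableT_comp mK (measurable_affine (a / 2) (1 - a / 2))).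
have C1E : (0 <= C1%:E :> \bar R)%E by rewrite lee_fin.
have -> := @ge0_integralZl _ _ _ mu setT measurableT _ mK' C1%:E (fun x _ => K0 _) C1E.
rewrite -/(\int[mu]_x K x)%E.
have -> : (\int[mu]_x K x = (a / 2)%:E * \int[mu]_x K (a / 2 * x + (1 - a / 2))%R)%E.
  by have := @ge0_integral_affine _ (a / 2) (1 - a / 2) K; rewrite gtr0_norm //; apply=>
    //; rewrite gt_eqF.
rewrite muleA -EFinM -/C1 (_ : C1 * (2 / a) * (a / 2) = C1) //.
by field; rewrite gt_eqF.
Qed.

(** The interval stops short of 1, where the weight is unbounded if [b] is negative; [radial_mass]
    reaches 1 by monotone convergence. *)
Lemma radial_mass_itv (y : R) : 0 < y < 1 ->
  (\int[mu]_(x in `[0%R, y]) (wt x)%:E = ((1 - (1 - y ^+ 2) `^ (b + 1)) / 2)%:E)%E.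
Proof.
move=> /andP[y0 y1].
pose F (x : R) := - (1 - x ^+ 2) `^ (b + 1) / 2.
pose g (x : R) := (b + 1) * x * (1 - x ^+ 2) `^ b.
have pos (x : R) : `|x| < 1 -> 0 < 1 - x ^+ 2.
  by rewrite ltr_norml => /andP[h1 h2]; nra.
have dpow (e x : R) : 0 < x -> is_derive x 1 ((@powR R)^~ e) (e * x `^ (e - 1)).
  move=> x0; have xI : x \in `]0, +oo[ by rewrite in_itv /= x0.
  apply: DeriveDef; first exact: derivable_powR.
  by rewrite -derive1E powR_derive1.
have dq (x : R) : is_derive x 1 (fun x : R => 1 - x ^+ 2) (- (2 * x)).
  have := @is_deriveB R R R (cst 1) (fun x : R => x ^+ 2) x 1 0 (2 * x) (is_derive_cst _
    _ _).
  rewrite sub0r; apply.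
  have := @is_deriveX R R id 2 x 1 1 (is_derive_id _ _).
  by rewrite exprfctE /= expr1 /GRing.scale /= mulr1.
have dcomp (e x : R) : `|x| < 1 ->
    is_derive x 1 (fun x : R => (1 - x ^+ 2) `^ e) (e * (1 - x ^+ 2) `^ (e - 1) * - (2 *
      x)).
  by move=> x1; exact: (@is_derive1_comp R (@powR R ^~ e) (fun x : R => 1 - x ^+ 2) x _ _
    (dpow e (1 - x ^+ 2) (pos x x1)) (dq x)).
have dF (x : R) : `|x| < 1 -> is_derive x 1 F (g x).
  move=> x1.
  have -> : F = - 2^-1 \*: (fun x : R => (1 - x ^+ 2) `^ (b + 1)).
    apply/funext => z; rewrite /F -[RHS]/(- 2^-1 * (1 - z ^+ 2) `^ (b + 1)).
    by rewrite [LHS]mulrC mulrN mulNr.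
  have -> : g x = - 2^-1 *: ((b + 1) * (1 - x ^+ 2) `^ (b + 1 - 1) * - (2 * x)).
    rewrite addrK -[RHS]/(- 2^-1 * ((b + 1) * (1 - x ^+ 2) `^ b * - (2 * x))) /g.
    by field.
  exact: is_deriveZ (dcomp (b + 1) x x1).
have cF (x : R) : `|x| < 1 -> {for x, continuous F}.
  by move=> /dF [h _]; apply: differentiable_continuous; exact/derivable1_diffP.
have cg (x : R) : `|x| < 1 -> {for x, continuous g}.
  move=> x1; have [h _] := dcomp b x x1.
  have cc : {for x, continuous (fun x : R => (1 - x ^+ 2) `^ b)}.
    by apply: differentiable_continuous; exact/derivable1_diffP.
  by apply: cvgM cc; apply: cvgM; [exact: cvg_cst|exact: cvg_id].
transitivity (\int[mu]_(x in `[0%R, y]) (g x)%:E)%E.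
  apply: eq_integral => x; rewrite inE /= in_itv /= => /andP[x0 xy].
  by rewrite /radial_weight ger0_norm // (le_lt_trans xy y1).
rewrite (@continuous_FTC2 _ g F) //.
- by rewrite -EFinB /F expr0n subr0 powR1; congr (_%:E); field.
- apply: continuous_in_subspaceT => x; rewrite inE /= in_itv /= => /andP[x0 xy].
  by apply: cg; rewrite ger0_norm // (le_lt_trans xy).
- split.
  + move=> x; rewrite in_itv /= => /andP[x0 xy].
    have x1 : `|x| < 1 by rewrite gtr0_norm // (lt_trans xy).
    by have [] := dF x x1.
  + by apply: cvg_at_right_filter; apply: cF; rewrite normr0.
  + by apply: cvg_at_left_filter; apply: cF; rewrite gtr0_norm.
- move=> x; rewrite in_itv /= => /andP[x0 xy]; rewrite derive1E.
  have x1 : `|x| < 1 by rewrite gtr0_norm // (lt_trans xy).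
  by have [_ ->] := dF x x1.
Qed.

(** Positivity of the mass lets the value at the origin bound the norm from below; its finiteness
    lets [hmean c 1] bound it from above. *)
Lemma radial_mass : exists2 m : R, 0 < m & (\int[mu]_x (wt x)%:E = m%:E)%E.
Proof.
have mwt : measurable_fun (setT : set T) (fun x => (wt x)%:E).
  by apply/measurable_EFinP; exact: measurable_radial_weight.
have w0 x : (0 <= (wt x)%:E)%E by rewrite lee_fin radial_weight_ge0.
have mwtS (A : set T) : measurable_fun A (fun x => (wt x)%:E).
  exact: measurable_funS measurableT (@subsetT _ _) mwt.
have b0 : 0 < b + 1 by move: b1; lra.
have IE : (\int[mu]_x (wt x)%:E = 2%:E * \int[mu]_(x in `[0%R, 1%R[) (wt x)%:E)%E.
  rewrite ge0_integral_even //; last 2 first.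
  - by move=> x; rewrite /radial_weight normrN sqrrN.
  - by rewrite /radial_weight normr0 mulr0 mul0r; case: ifP.
  congr (_ * _)%E; rewrite [RHS]integral_mkcond; apply: eq_integral => x _.
  rewrite patchE mem_setE in_itv /=; case: (ltgtP 0 x) => x0 //=.
    by case: ltP => // x1; rewrite /radial_weight gtr0_norm // ltNge x1.
  by rewrite -x0 ltr01 /radial_weight normr0 mulr0 mul0r; case: ifP.
set I := (\int[mu]_(x in `[0%R, 1%R[) (wt x)%:E)%E in IE.
pose y (n : nat) : R := 1 - n.+2%:R^-1.
have y01 n : 0 < y n < 1.
  by rewrite /y subr_gt0 invf_lt1 ?ltr1n //= gtrBl invr_gt0 ltr0n.
have Ile : (I <= (2^-1)%:E)%E.
  have UE : `[0%R, 1%R[%classic = \bigcup_n `[0%R, y n]%classic :> set T.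
    apply/seteqP; split => [x /=|x [n _ /=]]; rewrite !in_itv /= => /andP[x0 x1].
      have [N _ hN] := @nbhs_infty_ger R (1 - x)^-1.
      exists N => //=; rewrite in_itv /= x0 /= /y lerBrDl -lerBrDr.
      rewrite invf_ple ?posrE ?subr_gt0 //.
      by apply: le_trans (hN N (leqnn _)) _; rewrite ler_nat leqW // leqW.
    by rewrite x0 /= (le_lt_trans x1) //; case/andP: (y01 n).
  have nd : nondecreasing_seq (fun n => `[0%R, y n]%classic : set T).
    move=> m n mn; apply/subsetPset => x /=; rewrite !in_itv /= => /andP[-> /=]
      /le_trans; apply.
    by rewrite /y lerD2l lerN2 lef_pV2 ?posrE ?ltr0n // ler_nat !ltnS.
  have := @ge0_nondecreasing_set_cvg_integral _ _ R (fun n => `[0%R, y n]%classic : set T)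
    (fun x => (wt x)%:E) mu nd (fun n => measurable_itv _) (fun n => mwtS _) (fun n x _
      => w0 x).
  rewrite -UE -/I => cvI; rewrite -(cvg_lim _ cvI) //.
  apply: lime_le; first by apply/cvg_ex; eexists; exact: cvI.
  apply: nearW => n; rewrite radial_mass_itv // lee_fin.
  rewrite -[X in _ <= X]mul1r ler_wpM2r ?invr_ge0 // gerBl powR_ge0.
  by [].
have Ige : (0 < I)%E.
  have h01 : 0 < (2^-1 : R) < 1 by apply/andP; split; lra.
  have le1 : (\int[mu]_(x in `[0%R, 2^-1%R]) (wt x)%:E <= I)%E.
    apply: ge0_subset_integral => //.
    by move=> x /=; rewrite !in_itv /= => /andP[-> /= h]; apply: le_lt_trans h _; lra.
  apply: lt_le_trans le1.
  rewrite radial_mass_itv // lte_fin divr_gt0 // subr_gt0.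
  have h1 : 1 `^ (b + 1) = 1 :> R by rewrite powR1.
  rewrite -[X in _ < X]h1; apply: gt0_ltr_powR => //; rewrite ?nnegrE //; lra.
have Ifin : I \is a fin_num by rewrite ge0_fin_numE ?(ltW Ige) // (le_lt_trans Ile) //
  ltry.
exists (2 * fine I); first by rewrite mulr_gt0 // fine_gt0 // Ige ltey_eq Ifin.
by rewrite IE EFinM fineK.
Qed.

End Radial.

(** * The orbit of a semi-irregular vector *)

Section Family.
Variable R : realType.
Local Notation C := (Cplx R).
Variable a : R.
Hypothesis ha : 0 < a < 1.
Implicit Types (s t : R) (k l n j : nat) (z : C).

(* Taylor coefficients at the origin of [s / (s + 1 - z)]. *)
Definition pole_coef s l : R := s / (1 + s) ^+ l.+1.

Definition bump_coef s l : R := pole_coef s l - pole_coef (a * s) l.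

(** The second quotient cancels the limit 1 of the first as [s] tends to infinity, so there is decay
    at both ends: as a function of the logarithm of [s] this is a bump. *)
Definition log_bump s z : C :=
  s%:C / ((1 + s)%:C - z) - (a * s)%:C / ((1 + a * s)%:C - z).

Let a0 : 0 < a. Proof. by case/andP: ha. Qed.
Let a1 : a < 1. Proof. by case/andP: ha. Qed.

Lemma pole_coef_ge0 s l : 0 < s -> 0 <= pole_coef s l <= s.
Proof.
move=> s0; have h : 1 <= (1 + s) ^+ l.+1 by rewrite exprn_ege1 // lerDl ltW.
have h0 : 0 < (1 + s) ^+ l.+1 by exact: lt_le_trans h.
by rewrite /pole_coef divr_ge0 ?(ltW s0) ?(ltW h0) //= ler_pdivrMr // ler_peMr // ltW.
Qed.

Lemma bump_coef_le s l : 0 < s -> `|bump_coef s l| <= s.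
Proof.
move=> s0; have as0 : 0 < a * s by rewrite mulr_gt0.
have /andP[h1 h2] := pole_coef_ge0 l s0; have /andP[h3 h4] := pole_coef_ge0 l as0.
have ass : a * s <= s by rewrite ler_piMl // ltW.
by rewrite /bump_coef ler_norml; apply/andP; split; lra.
Qed.

Lemma pole_csum s z : 0 < s -> normc z < 1 ->
  has_csum (fun l => (pole_coef s l)%:C * z ^+ l) (s%:C / ((1 + s)%:C - z)).
Proof.
move=> s0 z1; have s1 : 0 < 1 + s by lra.
have s1C : (1 + s)%:C != 0 :> C by rewrite -normc_eq0 mod_real normr_eq0 gt_eqF.
pose q : C := z / (1 + s)%:C.
have qm : normc q = normc z / (1 + s).
  have -> : q = z * ((1 + s)^-1)%:C by rewrite /q fmorphV.
  by rewrite modM mod_real ger0_norm ?invr_ge0 // ltW.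
have q1 : normc q < 1 by rewrite qm ltr_pdivrMr //; have := normc_ge0 z; lra.
have den : (1 + s)%:C - z != 0 :> C.
  rewrite subr_eq0; apply/eqP => h; have := z1.
  by rewrite -h mod_real gtr0_norm //; lra.
have part n : \sum_(k < n) (pole_coef s k)%:C * z ^+ k =
    s%:C / ((1 + s)%:C - z) * (1 - q ^+ n).
  elim: n => [|n IH]; first by rewrite big_ord0 expr0 subrr mulr0.
  rewrite big_ord_recr /= IH /pole_coef rmorphM fmorphV rmorphXn /=.
  rewrite /q !expr_div_n !exprS; have V0 := expf_neq0 n s1C; move: V0 den s1C.
  move: (z ^+ n) ((1 + s)%:C ^+ n) (s%:C) ((1 + s)%:C) => Z V U W V0 den s1C.
  by field; rewrite V0 s1C den.
move=> e e0; pose B : R := normc (s%:C / ((1 + s)%:C - z)).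
have B0 : 0 <= B by exact: normc_ge0.
have /cvgrPdist_lt/(_ (e / (B + 1))) h : geometric 1 (normc q) @ \oo --> 0.
  by apply: cvg_geometric; rewrite ger0_norm ?normc_ge0.
have [|N _ hN] := h; first by rewrite divr_gt0 // ltr_wpDl.
exists N => n /hN; rewrite /geometric /= mul1r sub0r normrN ger0_norm ?exprn_ge0
  ?normc_ge0 // => hn.
rewrite part mulrBr mulr1 opprB addrCA subrr addr0 modM modX -/B.
have B1 : 0 < B + 1 by lra.
rewrite ltr_pdivlMr // in hn; apply: le_lt_trans hn.
by rewrite mulrC ler_wpM2l ?exprn_ge0 ?normc_ge0 // lerDl.
Qed.

Lemma bump_csum s z : 0 < s -> normc z < 1 ->
  has_csum (fun l => (bump_coef s l)%:C * z ^+ l) (log_bump s z).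
Proof.
move=> s0 z1; have as0 : 0 < a * s by rewrite mulr_gt0.
have := has_csumD (pole_csum s0 z1) (has_csumZ (-1) (pole_csum as0 z1)).
rewrite mulN1r; apply: has_csum_eq => l.
by rewrite /bump_coef rmorphB mulN1r -mulrBl.
Qed.

(* The point of the construction: the operator acts on bumps as a shift. *)
Lemma bump_contract s z : normc z < 1 -> 0 < s ->
  log_bump s (a%:C * z + (1 - a)%:C) = log_bump (s / a) z.
Proof.
move=> z1 s0; rewrite /log_bump.
have aC : a%:C != 0 :> C by rewrite -normc_eq0 mod_real normr_eq0 gt_eqF.
have nz (t : R) : 0 < t -> (1 + t)%:C - z != 0 :> C.
  move=> t0; rewrite subr_eq0; apply/eqP => h; have := z1.
  by rewrite -h mod_real gtr0_norm; lra.
have E (t : R) : (1 + t)%:C - (a%:C * z + (1 - a)%:C) = a%:C * ((1 + t / a)%:C - z) :> C.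
  rewrite !rmorphD rmorphN rmorphM fmorphV rmorph1 /=.
  by move: aC; move: (a%:C) (t%:C) => A T0 aC; field.
have F (t : R) : 0 < t -> t%:C / (a%:C * ((1 + t / a)%:C - z)) = (t / a)%:C / ((1 + t /
  a)%:C - z) :> C.
  move=> t0; have := nz (t / a) (divr_gt0 t0 a0).
  rewrite [in X in _ = X / _]rmorphM [in X in _ = X / _]fmorphV /=.
  move: aC; move: (a%:C) (t%:C) ((1 + t / a)%:C - z) => A T0 W aC W0; field.
  by rewrite W0 aC.
rewrite !E !F ?mulr_gt0 // [in RHS](_ : a * (s / a) = a * s / a) //.
by rewrite mulrA.
Qed.

Lemma pole_sqsum s n : 0 < s -> \sum_(l < n) pole_coef s l ^+ 2 <= s / (s + 2).
Proof.
move=> s0; pose r : R := ((1 + s) ^+ 2)^-1.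
have s1 : 1 < (1 + s) ^+ 2 by rewrite exprn_egt1 // ltrDl.
have r01 : 0 <= r < 1.
  by rewrite invr_ge0 sqr_ge0 /= invf_lt1 // (lt_trans ltr01).
have -> : \sum_(l < n) pole_coef s l ^+ 2 = s ^+ 2 * r * \sum_(l < n) r ^+ l.
  rewrite mulr_sumr; apply: eq_bigr => l _.
  rewrite /pole_coef /r expr_div_n exprVn -!exprM [(l.+1 * 2)%N]mulnC mulnS exprD invfM.
  by rewrite mulrA.
apply: le_trans (_ : s ^+ 2 * r * (1 - r)^-1 <= _).
  by rewrite ler_wpM2l ?geometric_sum_le // mulr_ge0 ?sqr_ge0 //; case/andP: r01.
rewrite (_ : s ^+ 2 * r * (1 - r)^-1 = s / (s + 2)) //.
by rewrite /r; field; apply/and3P; split; rewrite gt_eqF //; nra.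
Qed.

(** For large [s] the constant coefficient of a pole tends to 1. Leaving it out gains the factor
    [(1 + s) ^- 2]. *)
Lemma pole_sqsum_tail s n : 0 < s -> \sum_(l < n) pole_coef s l.+1 ^+ 2 <= s^-1 ^+ 2.
Proof.
move=> s0; have s1 : 0 < 1 + s by lra.
have -> : \sum_(l < n) pole_coef s l.+1 ^+ 2 = (1 + s) ^- 2 * \sum_(l < n) pole_coef s l
  ^+ 2.
  rewrite mulr_sumr; apply: eq_bigr => l _.
  have E : pole_coef s l.+1 = (1 + s)^-1 * pole_coef s l.
    by rewrite /pole_coef [in LHS]exprS invfM mulrCA.
  by rewrite E exprMn exprVn.
rewrite exprVn -[X in _ <= X]mulr1; apply: ler_pM.
- by rewrite invr_ge0 sqr_ge0.
- by rewrite sumr_ge0 // => l _; exact: sqr_ge0.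
- by rewrite lef_pV2 ?posrE ?exprn_gt0 // lerXn2r ?nnegrE ?(ltW s0) ?(ltW s1) //; lra.
apply: le_trans (pole_sqsum n s0) _; rewrite ler_pdivrMr; last by lra.
by rewrite mul1r; lra.
Qed.

Lemma bump_sqsum_small s n : 0 < s -> \sum_(l < n) bump_coef s l ^+ 2 <= s.
Proof.
move=> s0; have as0 : 0 < a * s by rewrite mulr_gt0.
apply: le_trans (_ : \sum_(l < n) (pole_coef s l ^+ 2 + pole_coef (a * s) l ^+ 2) <= _).
  apply: ler_sum => l _; have /andP[h1 _] := pole_coef_ge0 l s0.
  have /andP[h2 _] := pole_coef_ge0 l as0; rewrite /bump_coef; nra.
rewrite big_split /=; apply: le_trans (lerD (pole_sqsum n s0) (pole_sqsum n as0)) _.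
have h (t : R) : 0 < t -> t / (t + 2) <= t / 2.
  by move=> t0; rewrite ler_pM2l // lef_pV2 ?posrE //; lra.
have := h s s0; have := h _ as0.
have : a * s <= s by rewrite ler_piMl // ltW.
lra.
Qed.

(** Only the constant coefficient needs the cancellation between the two poles; the others are small
    in each pole separately. The constant 3 counts these three contributions. *)
Lemma bump_sqsum_large s n : 0 < s ->
  \sum_(l < n) bump_coef s l ^+ 2 <= 3 * (a * s)^-1 ^+ 2.
Proof.
move=> s0; have as0 : 0 < a * s by rewrite mulr_gt0.
have sum0 (u : nat -> R) : 0 <= \sum_(l < n) u l ^+ 2.
  by rewrite sumr_ge0 // => l _; exact: sqr_ge0.
have ass : s^-1 ^+ 2 <= (a * s)^-1 ^+ 2.
  rewrite lerXn2r ?nnegrE ?invr_ge0 ?(ltW s0) ?(ltW as0) //.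
  by rewrite lef_pV2 ?posrE // ler_piMl // ltW.
apply: le_trans (_ : \sum_(l < n.+1) bump_coef s l ^+ 2 <= _).
  by rewrite big_ord_recr /= lerDl sqr_ge0.
rewrite big_ord_recl /=.
have -> : 3 * (a * s)^-1 ^+ 2 = (a * s)^-1 ^+ 2 + ((a * s)^-1 ^+ 2 + (a * s)^-1 ^+ 2) :>
  R by ring.
apply: lerD.
  have -> : bump_coef s 0 = (1 + a * s)^-1 - (1 + s)^-1.
    by rewrite /bump_coef /pole_coef !expr1; field; rewrite !gt_eqF; lra.
  have h1 : 0 < (1 + s)^-1 by rewrite invr_gt0; lra.
  have h2 : (1 + s)^-1 <= (1 + a * s)^-1.
    rewrite lef_pV2 ?posrE; [|lra|lra].
    by rewrite lerD2l ler_piMl // ltW.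
  have h3 : (1 + a * s)^-1 <= (a * s)^-1 by rewrite lef_pV2 ?posrE //; lra.
  by rewrite lerXn2r ?nnegrE; lra.
apply: le_trans (_ : \sum_(l < n) (pole_coef s l.+1 ^+ 2 + pole_coef (a * s) l.+1 ^+ 2)
  <= _).
  apply: ler_sum => l _; rewrite /bump /= add1n; have /andP[h1 _] := pole_coef_ge0 l.+1
    s0.
  have /andP[h2 _] := pole_coef_ge0 l.+1 as0; rewrite /bump_coef; nra.
rewrite big_split /=; apply: lerD; last exact: pole_sqsum_tail.
exact: le_trans (pole_sqsum_tail n s0) ass.
Qed.

Definition scale k n : R := a ^+ k / a ^+ n.

Definition gap k n : nat := ((k - n) + (n - k))%N.

(** For small [s] the squared norm of a bump is only bounded by [s], so the norm is controlled by a
    square root; the faster decay for large [s] is not exploited. *)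
Definition rate : R := Num.sqrt a.

Lemma rate_gt0 : 0 < rate. Proof. by rewrite sqrtr_gt0. Qed.

Lemma rate_lt1 : rate < 1. Proof. by rewrite -sqrtr1 ltr_sqrt. Qed.

Lemma scale_gt0 k n : 0 < scale k n.
Proof. by rewrite divr_gt0 // exprn_gt0. Qed.

Lemma bump_sqsum k n m :
  \sum_(l < m) bump_coef (scale k n) l ^+ 2 <= 3 / a ^+ 2 * (rate ^+ gap k n) ^+ 2.
Proof.
have rE i : (rate ^+ i) ^+ 2 = a ^+ i by rewrite exprAC sqr_sqrtr // ltW.
have sc := scale_gt0 k n; rewrite rE /gap.
have a2 : 1 <= 3 / a ^+ 2.
  rewrite ler_pdivlMr ?exprn_gt0 // mul1r; apply: (@le_trans _ _ 1); last by lra.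
  by rewrite expr_le1 // ltW.
case: (leqP n k) => nk.
  apply: le_trans (bump_sqsum_small m sc) _.
  have -> : (k - n + (n - k))%N = (k - n)%N by move/eqP: nk => ->; rewrite addn0.
  have -> : scale k n = a ^+ (k - n).
    by rewrite /scale -{1}(subnK nk) exprD mulfK // expf_neq0 // gt_eqF.
  by rewrite ler_peMl // exprn_ge0 // ltW.
apply: le_trans (bump_sqsum_large m sc) _.
have -> : (k - n + (n - k))%N = (n - k)%N by move/ltnW/eqP: nk => ->.
have sE : (scale k n)^-1 = a ^+ (n - k).
  rewrite /scale invf_div -{1}(subnK (ltnW nk)) exprD mulfK // expf_neq0 // gt_eqF //.
rewrite invfM exprMn sE exprVn mulrA ler_wpM2l ?divr_ge0 ?exprn_ge0 ?(ltW a0) //.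
by rewrite expr2 ler_piMl ?exprn_ge0 ?exprn_ile1 ?(ltW a0) ?(ltW a1).
Qed.

End Family.

(** * Superposition of bumps at the squares *)

Section Orbit.
Variable R : realType.
Local Notation C := (Cplx R).
Variable a : R.
Hypothesis ha : 0 < a < 1.
Implicit Types (s t : R) (k l n j m : nat) (z : C).

Let a0 : 0 < a. Proof. by case/andP: ha. Qed.
Let a1 : a < 1. Proof. by case/andP: ha. Qed.

Definition square k : bool := `[< exists j, k = (j * j)%N >].

(** [j * j.+1] lies [j] above the square of [j] and [j.+1] below the next square. *)
Lemma square_gap j k : square k -> (j <= gap k (j * j.+1))%N.
Proof.
move=> /asboolP[i ->]; rewrite /gap; case: (leqP i j) => ij.
  apply: leq_trans (leq_addl _ _); rewrite leq_subRL; last by rewrite leq_mul // leqW.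
  by rewrite mulnS addnC leq_add2l leq_mul.
apply: leq_trans (leq_addr _ _); rewrite leq_subRL; last by rewrite leq_mul // ltnW.
apply: leq_trans (_ : j.+1 * j.+1 <= _)%N; last by rewrite leq_mul.
by rewrite mulSn addnC leq_add2r.
Qed.

Local Notation q := (rate a).
Let q0 : 0 < q. Proof. exact: rate_gt0. Qed.
Let q1 : q < 1. Proof. exact: rate_lt1. Qed.

Lemma tail_sum_le D m : \sum_(i < m) (if (D <= i)%N then q ^+ i else 0) <= q ^+ D / (1 -
  q).
Proof.
pose f i : R := if (D <= i)%N then q ^+ i else 0.
have f0 i : 0 <= f i by rewrite /f; case: ifP => // _; rewrite exprn_ge0 // ltW.
apply: le_trans (_ : \sum_(i < D + m) f i <= _).
  by rewrite addnC big_split_ord /= lerDl sumr_ge0.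
rewrite big_split_ord /= big1 ?add0r; last by move=> i _; rewrite /f leqNgt ltn_ord.
apply: le_trans (_ : q ^+ D * \sum_(i < m) q ^+ i <= _).
  by rewrite mulr_sumr; apply: ler_sum => i _; rewrite /f leq_addr exprD.
by rewrite ler_wpM2l ?exprn_ge0 ?geometric_sum_le ?(ltW q0) ?q1.
Qed.

(** On either side of [n] each gap occurs at most once, so two geometric tails starting at [D]
    dominate the sum. *)
Lemma gap_sum_le n D m : (forall k, square k -> (D <= gap k n)%N) ->
  \sum_(k < m) (square k)%:R * q ^+ gap k n <= 2 * (q ^+ D / (1 - q)).
Proof.
move=> hD; pose f i : R := if (D <= i)%N then q ^+ i else 0.
have f0 i : 0 <= f i by rewrite /f; case: ifP => // _; rewrite exprn_ge0 // ltW.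
apply: le_trans (_ : \sum_(k < m) f (gap k n) <= _).
  apply: ler_sum => k _; case: (boolP (square k)) => sk; last by rewrite mul0r.
  by rewrite mul1r /f hD.
apply: le_trans (_ : \sum_(k < n + m) f (gap k n) <= _).
  by rewrite addnC big_split_ord /= lerDl sumr_ge0.
rewrite big_split_ord /= (_ : 2 = 1 + 1) // mulrDl mul1r; apply: lerD; last first.
  apply: le_trans (tail_sum_le D m); apply: ler_sum => i _.
  by rewrite /gap addKn (_ : n - (n + i) = 0)%N ?addn0 //; apply/eqP; rewrite subn_eq0
    leq_addr.
(* Read backwards, the indices below [n] have gaps 1 to [n]; the exponent 0 is an extra term, hence
   [n.+1]. *)
apply: le_trans (tail_sum_le D n.+1).
rewrite big_ord_recl -[X in X <= _]add0r; apply: lerD; first exact: f0.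
rewrite (reindex_inj rev_ord_inj) /=; apply: ler_sum => i _.
have -> : gap (n - i.+1) n = i.+1.
  rewrite /gap (_ : n - i.+1 - n = 0)%N; first by rewrite add0n subKn // ltn_ord.
  by apply/eqP; rewrite subn_eq0 leq_subr.
by [].
Qed.

(** Taylor coefficient [l] of the [k]-th bump after [n] steps. Each iterate is defined by its own
    series, and [orbit_fun_comp] links consecutive ones afterwards. *)
Definition orbit_term n l k : R := (square k)%:R * bump_coef a (scale a k n) l.

Lemma orbit_term_le n l k : `|orbit_term n l k| <= scale a k n.
Proof.
rewrite normrM; case: (square k); rewrite ?normr1 ?normr0 ?mul1r ?mul0r.
  exact: bump_coef_le (scale_gt0 ha _ _).
by rewrite ltW // scale_gt0.
Qed.

Lemma scale_sum_le n m : \sum_(k < m) scale a k n <= (a ^+ n)^-1 / (1 - a).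
Proof.
rewrite -mulr_suml mulrC ler_wpM2l ?invr_ge0 ?exprn_ge0 ?(ltW a0) //.
by rewrite geometric_sum_le // (ltW a0) a1.
Qed.

Lemma orbit_coef_ex n l : exists x, has_csum (fun k => (orbit_term n l k)%:C : C) x.
Proof.
apply: (@abs_bdd_csum _ _ ((a ^+ n)^-1 / (1 - a))) => m.
apply: le_trans (scale_sum_le n m); apply: ler_sum => k _.
by rewrite mod_real orbit_term_le.
Qed.

Definition orbit_coef n l : C := projT1 (cid (orbit_coef_ex n l)).

Lemma orbit_coefP n l : has_csum (fun k => (orbit_term n l k)%:C : C) (orbit_coef n l).
Proof. by rewrite /orbit_coef; case: cid. Qed.

Lemma orbit_coef_radge n : radge (orbit_coef n) 1.
Proof.
apply: (@radge_bounded _ _ _ ((a ^+ n)^-1 / (1 - a))) => l; rewrite expr1n mulr1.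
apply: (abs_bdd_le _ (orbit_coefP n l)) => m.
apply: le_trans (scale_sum_le n m); apply: ler_sum => k _.
by rewrite mod_real orbit_term_le.
Qed.

Lemma orbit_fun_ex n (z : disk R) : exists x, has_csum (fun l => orbit_coef n l * val z
  ^+ l) x.
Proof. by apply: (radge_has_csum (orbit_coef_radge n)); exact: (valP z). Qed.

Definition orbit_fun n (z : disk R) : C := projT1 (cid (orbit_fun_ex n z)).

Lemma orbit_fun_coefs n : has_coefs (orbit_fun n) (orbit_coef n).
Proof. by move=> z; rewrite /orbit_fun; case: cid. Qed.

(** Exchanging the sums over powers and over bumps puts the function in the form on which
    [bump_contract] acts term by term. *)
Lemma orbit_fun_csum n (z : disk R) :
  has_csum (fun k => (square k)%:R * log_bump a (scale a k n) (val z)) (orbit_fun n z).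
Proof.
have z1 : normc (val z) < 1 by exact: (valP z).
pose B : R := (a ^+ n)^-1 / (1 - a).
have B0 : 0 <= B by have := scale_sum_le n 0; rewrite big_ord0.
apply: (@has_csum_exchange _ (fun l k => (orbit_term n l k)%:C * val z ^+ l)
  ((1 - normc (val z))^-1 * B) (fun l => orbit_coef n l * val z ^+ l)).
- move=> m1 m2; apply: le_trans (_ : \sum_(l < m1) normc (val z) ^+ l * B <= _).
    apply: ler_sum => l _; apply: le_trans (_ : \sum_(k < m2) normc (val z) ^+ l * scale
      a k n <= _).
      apply: ler_sum => k _; rewrite modM modX mod_real mulrC.
      by rewrite ler_wpM2l ?exprn_ge0 ?normc_ge0 // orbit_term_le.
    by rewrite -mulr_sumr ler_wpM2l ?exprn_ge0 ?normc_ge0 // scale_sum_le.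
  by rewrite -mulr_suml ler_wpM2r // geometric_sum_le // normc_ge0 z1.
- move=> l; rewrite mulrC; apply: has_csum_eq (has_csumZ (val z ^+ l) (orbit_coefP n l))
  => k.
  by rewrite mulrC.
- move=> k; have := has_csumZ ((square k)%:R : C) (bump_csum ha (scale_gt0 ha k n) z1).
  apply: has_csum_eq => l; rewrite /orbit_term rmorphM mulrA; congr (_ * _ * _).
  by rewrite rmorph_nat.
- exact: orbit_fun_coefs.
Qed.

Lemma orbit_fun_comp n : comp_op (affine_map ha) (orbit_fun n) = orbit_fun n.+1.
Proof.
apply/funext => z; rewrite /comp_op /=.
have z1 : normc (val z) < 1 by exact: (valP z).
apply: (has_csum_unique _ (orbit_fun_csum n.+1 z)).
apply: has_csum_eq (orbit_fun_csum n (affine_map ha z)) => k; congr (_ * _).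
rewrite /= bump_contract ?scale_gt0 //; congr (log_bump _ _ _).
by rewrite /scale exprSr invfM mulrA.
Qed.

(** Cauchy-Schwarz with weights [q ^+ gap k n] stands in for the triangle inequality of the Hardy
    norm. Divided by its weight, each bump has squared norm at most [3 / a ^+ 2]; the total weight,
    bounded by [gap_sum_le], enters twice. *)
Lemma orbit_hmean_le n D : (forall k, square k -> (D <= gap k n)%N) ->
  (hmean (orbit_coef n) 1 <= (3 / a ^+ 2 * (2 * (q ^+ D / (1 - q))) ^+ 2)%:E)%E.
Proof.
move=> hD; apply: hmean_le => m; rewrite lee_fin.
under eq_bigr do rewrite expr1n mulr1.
set B := 2 * _; pose w k : R := (square k)%:R * q ^+ gap k n.
have w0 k : 0 <= w k by rewrite mulr_ge0 ?ler0n // exprn_ge0 // ltW.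
have Cge : 0 <= 3 / a ^+ 2 by rewrite divr_ge0 // exprn_ge0 // ltW.
have part K : \sum_(l < m) (normc (\sum_(k < K) (orbit_term n l k)%:C : C)) ^+ 2 <= 3 /
  a ^+ 2 * B ^+ 2.
  have wB : \sum_(k < K) w k <= B by exact: gap_sum_le.
  have wS0 : 0 <= \sum_(k < K) w k by rewrite sumr_ge0.
  pose e l k := bump_coef a (scale a k n) l / q ^+ gap k n.
  have qn k : q ^+ gap k n != 0 by rewrite expf_neq0 // gt_eqF.
  have termE l k : orbit_term n l k = w k * e l k.
    by rewrite /orbit_term /w /e -mulrA; congr (_ * _); rewrite mulrC divfK.
  apply: le_trans (_ : \sum_(l < m) (\sum_(k < K) w k) * (\sum_(k < K) w k * e l k ^+ 2)
    <= _).
    apply: ler_sum => l _; apply: le_trans (cauchy_schwarz_weighted (e l) K w0).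
    rewrite le_eqVlt; apply/orP; left; apply/eqP.
    rewrite -[RHS]real_normK ?num_real //; congr (_ ^+ 2); rewrite -mod_real; congr normc.
    by rewrite rmorph_sum; apply: eq_bigr => k _; rewrite termE.
  rewrite -mulr_sumr exchange_big /=.
  have -> : 3 / a ^+ 2 * B ^+ 2 = B * (B * (3 / a ^+ 2)) by ring.
  apply: ler_pM => //; first by rewrite sumr_ge0 // => k _; rewrite sumr_ge0 // => l _;
    rewrite mulr_ge0 ?sqr_ge0.
  apply: le_trans (_ : (\sum_(k < K) w k) * (3 / a ^+ 2) <= _); last by rewrite ler_wpM2r.
  rewrite mulr_suml; apply: ler_sum => k _; rewrite -mulr_sumr ler_wpM2l //.
  have q2 : 0 < (q ^+ gap k n) ^+ 2 by rewrite !exprn_gt0.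
  have -> : \sum_(l < m) e l k ^+ 2 = (\sum_(l < m) bump_coef a (scale a k n) l ^+ 2) /
    (q ^+ gap k n) ^+ 2.
    by rewrite mulr_suml; apply: eq_bigr => l _; rewrite expr_div_n.
  by rewrite ler_pdivrMr //; exact: bump_sqsum.
have cv : (fun K => \sum_(l < m) (normc (\sum_(k < K) (orbit_term n l k)%:C : C)) ^+ 2)
  @ \oo -->
    \sum_(l < m) normc (orbit_coef n l) ^+ 2.
  apply: (@cvg_sum_ord _ (fun l K => (normc (\sum_(k < K) (orbit_term n l k)%:C : C)) ^+
    2)
    (fun l => normc (orbit_coef n l) ^+ 2)) => l.
  exact: cvg_sqr (has_csum_cvg_mod (orbit_coefP n l)).
rewrite -(cvg_lim _ cv) //; apply: limr_le; first by apply/cvg_ex; eexists; exact: cv.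
exact: nearW.
Qed.

(** All bumps are nonnegative at the origin, so nothing cancels. The term [k = n] has scale 1 and
    contributes [(1 + a)^-1 - 2^-1], which is the stated constant. *)
Lemma orbit_coef0_ge n : square n -> (1 - a) / (2 * (1 + a)) <= normc (orbit_coef n 0).
Proof.
move=> sn; set de := _ / _.
have b0 s : 0 < s -> 0 <= bump_coef a s 0.
  move=> s0; have as0 : 0 < a * s by rewrite mulr_gt0.
  have -> : bump_coef a s 0 = (1 + a * s)^-1 - (1 + s)^-1.
    by rewrite /bump_coef /pole_coef !expr1; field; rewrite !gt_eqF; lra.
  rewrite subr_ge0 lef_pV2 ?posrE; [|lra|lra].
  by rewrite lerD2l ler_piMl // ltW.
have t0 k : 0 <= orbit_term n 0 k by rewrite mulr_ge0 ?ler0n // b0 // scale_gt0.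
have tn : orbit_term n 0 n = de.
  rewrite /orbit_term sn mul1r /scale divff ?expf_neq0 ?gt_eqF //.
  have a1n : 1 + a != 0 by rewrite gt_eqF // addr_gt0.
  by rewrite /bump_coef /pole_coef /de !mulr1 !expr1; field.
apply/ler_addgt0Pr => e e0; have [N hN] := orbit_coefP n 0 e0.
have := hN (maxn N n.+1) (leq_maxl _ _); set S := \sum_(k < _) _ => hS.
have : de <= normc S.
  have -> : S = (\sum_(k < maxn N n.+1) orbit_term n 0 k)%:C by rewrite rmorph_sum.
  rewrite mod_real ger0_norm ?sumr_ge0 //.
  rewrite -(subnKC (leq_maxr N n.+1)) big_split_ord /= big_ord_recr /= tn.
  by rewrite [X in _ <= X + _]addrC -addrA lerDl addr_ge0 // sumr_ge0.
have := mod_le_sub S (orbit_coef n 0); rewrite mod_distC; lra.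
Qed.

End Orbit.

(** * Li-Yorke chaos *)

Section Criterion.
Variable R : realType.
Local Notation C := (Cplx R).
Local Notation mu := (@lebesgue_measure R).
Implicit Types (f : disk R -> C) (c : nat -> C).

Lemma limn_einf_eq0 (d : nat -> R) : (forall n, 0 <= d n) ->
  (forall e, 0 < e -> forall N, exists2 n, (N <= n)%N & d n <= e) ->
  limn_einf (fun n => (d n)%:E) = 0%E.
Proof.
move=> d0 hd; rewrite limn_einf_lim.
suff -> : einfs (fun n => (d n)%:E) = cst 0%E by exact: lim_cst.
apply/funext => N; rewrite /einfs; apply/eqP; rewrite eq_le; apply/andP; split.
  apply/lee_addgt0Pr => e e0; rewrite add0e.
  have [n Nn dn] := hd e e0 N; apply: ge_ereal_inf.
  by exists (d n)%:E; [exists n|rewrite lee_fin].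
by apply: le_ereal_inf_tmp => _ [n _ <-]; rewrite lee_fin.
Qed.

Lemma limn_esup_gt0 (d : nat -> R) (e : R) : 0 < e ->
  (forall N, exists2 n, (N <= n)%N & e <= d n) ->
  (0 < limn_esup (fun n => (d n)%:E))%E.
Proof.
move=> e0 hd; apply: lt_le_trans (_ : (e%:E <= _)%E); first by rewrite lte_fin.
rewrite limn_esup_lim; apply: lime_ge; first exact: is_cvg_esups.
apply: nearW => N; have [n Nn dn] := hd N.
apply: (@le_trans _ _ (d n)%:E); first by rewrite lee_fin.
by apply: ereal_sup_ubound; exists n.
Qed.

(** A countable set has Lebesgue measure zero, whereas the line has infinite measure. *)
Lemma uncountable_real : ~ countable [set: R].
Proof.
move=> h; have := countable_lebesgue_measure0 h.
rewrite -set_itvNyy lebesgue_measure_itv /= => /eqP.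
by [].
Qed.

Variable a : R.
Hypothesis ha : 0 < a < 1.
Local Notation phi := (affine_map ha).

(* [sq] is the square of the norm; only its comparison with the Taylor
   coefficients matters. *)
Variables (sq : (disk R -> C) -> \bar R) (k1 k2 K : R).
Hypotheses (k1_gt0 : 0 < k1) (k2_ge0 : 0 <= k2) (K_ge0 : 0 <= K).
Hypothesis sq_ge : forall f c, has_coefs f c -> ((k1 * normc (c 0%N) ^+ 2)%:E <= sq f)%E.
Hypothesis sq_le : forall f c, has_coefs f c -> (sq f <= k2%:E * hmean c 1)%E.
Hypothesis sq_scale : forall f (t : R), analytic f -> sq (t%:C *: f) = ((t ^+ 2)%:E * sq
  f)%E.
Hypothesis sq_comp : forall f, analytic f -> (sq (comp_op phi f) <= K%:E * sq f)%E.

Let X : set (disk R -> C) := [set f | analytic f /\ (sq f < +oo)%E].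
Let N f : R := Num.sqrt (fine (sq f)).
Let T := comp_op phi.
Let F := orbit_fun ha.

Let sq_ge0 f : analytic f -> (0 <= sq f)%E.
Proof.
move=> /analytic_has_coefs[c /sq_ge]; apply: le_trans.
by rewrite lee_fin mulr_ge0 ?sqr_ge0 // ltW.
Qed.

Lemma analytic_comp f : analytic f -> analytic (T f).
Proof.
move=> /analytic_has_coefs[c /(has_coefs_comp ha)[d hd _]].
exact: has_coefs_analytic hd.
Qed.

Lemma analytic_scale f (x : C) : analytic f -> analytic (x *: f).
Proof.
move=> /analytic_has_coefs[c hc]; apply: (@has_coefs_analytic _ _ (fun n => x * c n)) =>
  z.
by apply: has_csum_eq (has_csumZ x (hc z)) => n; rewrite mulrA.
Qed.

Lemma comp_op_bounded : bounded_operator X N T.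
Proof.
split=> [f [af sf]|x f g _ _ //|].
  split; first exact: analytic_comp.
  apply: le_lt_trans (sq_comp af) _; have s0 := sq_ge0 af.
  by rewrite -(fineK (_ : sq f \is a fin_num)) ?ge0_fin_numE // -EFinM ltry.
exists (Num.sqrt K) => f [af sf]; have s0 := sq_ge0 af.
have sfin : sq f \is a fin_num by rewrite ge0_fin_numE.
have sTfin : sq (T f) \is a fin_num.
  rewrite ge0_fin_numE; last exact: sq_ge0 (analytic_comp af).
  by apply: le_lt_trans (sq_comp af) _; rewrite -(fineK sfin) -EFinM ltry.
rewrite /N -sqrtrM // ler_wsqrtr // -lee_fin EFinM (fineK sfin) (fineK sTfin).
exact: sq_comp.
Qed.

Let F_analytic n : analytic (F n).
Proof. exact: has_coefs_analytic (orbit_fun_coefs ha n). Qed.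

Let sqF_le n D : (forall k, square k -> (D <= gap k n)%N) ->
  (sq (F n) <= (k2 * (3 / a ^+ 2 * (2 * (rate a ^+ D / (1 - rate a))) ^+ 2))%:E)%E.
Proof.
move=> hD; apply: le_trans (sq_le (orbit_fun_coefs ha n)) _.
by rewrite EFinM lee_wpmul2l ?lee_fin // orbit_hmean_le.
Qed.

Let sqF_fin n : sq (F n) \is a fin_num.
Proof.
rewrite ge0_fin_numE ?sq_ge0 //; apply: le_lt_trans (@sqF_le n 0 _) (ltry _).
by [].
Qed.

Let iter_scale n (t : R) : iter n T (t%:C *: F 0%N) = t%:C *: F n.
Proof.
elim: n => [//|n IH]; rewrite iterS IH.
have <- : T (F n) = F n.+1 by exact: orbit_fun_comp.
by [].
Qed.

Let iter_diff n (s t : R) :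
  iter n T (s%:C *: F 0%N) - iter n T (t%:C *: F 0%N) = (s - t)%:C *: F n.
Proof. by rewrite !iter_scale -scalerBl -rmorphB. Qed.

Let N_diff n (s t : R) :
  N (iter n T (s%:C *: F 0%N) - iter n T (t%:C *: F 0%N)) = `|s - t| * N (F n).
Proof.
rewrite iter_diff /N sq_scale // fineM // sqrtrM ?sqr_ge0 //.
by rewrite sqrtr_sqr.
Qed.

Let N_small e : 0 < e -> forall M, exists2 n, (M <= n)%N & N (F n) <= e.
Proof.
move=> e0 M.
have q01 : 0 < rate a < 1 by rewrite rate_gt0 // rate_lt1.
pose G D : R := k2 * (3 / a ^+ 2 * (2 * (rate a ^+ D / (1 - rate a))) ^+ 2).
have cG : G @ \oo --> (0 : R).
  have -> : (0 : R) = k2 * (3 / a ^+ 2 * (2 * (0 / (1 - rate a))) ^+ 2).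
    by rewrite mul0r mulr0 expr0n !mulr0.
  apply: cvgM; first exact: cvg_cst.
  apply: cvgM; first exact: cvg_cst.
  apply: cvg_sqr; apply: cvgM; first exact: cvg_cst.
  apply: cvgM; last exact: cvg_cst.
  have cq : geometric 1 (rate a) @ \oo --> (0 : R).
    by apply: cvg_geometric; case/andP: q01 => h1 h2; rewrite gtr0_norm.
  move: cq; rewrite (_ : geometric 1 (rate a) = GRing.exp (rate a)) //.
  by apply/funext => D; rewrite /= mul1r.
have /cvgrPdist_le/(_ (e ^+ 2)) h := cG.
have [|M' _ hM'] := h; first exact: exprn_gt0.
(* Times between consecutive squares: [M] makes the time late enough, and [M'] makes the gap [j] to
   all squares large enough. *)
pose j := maxn M M'; exists (j * j.+1)%N.
  by apply: leq_trans (leq_maxl M M') _; rewrite -/j leq_pmulr.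
have := hM' j (leq_maxr _ _); rewrite /= sub0r normrN => hj.
have Gj : G j <= e ^+ 2 by apply: le_trans hj; exact: ler_norm.
have := @sqF_le (j * j.+1) j (fun k => @square_gap j k).
rewrite -/(G j) -(fineK (sqF_fin _)) lee_fin => h2.
rewrite /N -(ger0_norm (ltW e0)) -sqrtr_sqr ler_wsqrtr //.
exact: le_trans h2 Gj.
Qed.

Let del : R := Num.sqrt (k1 * ((1 - a) / (2 * (1 + a))) ^+ 2).

Let del_gt0 : 0 < del.
Proof.
have /andP[a0 a1] := ha.
rewrite sqrtr_gt0 mulr_gt0 // exprn_gt0 // divr_gt0 // ?subr_gt0 // mulr_gt0 // addr_gt0
  //.
Qed.

Let N_large M : exists2 n, (M <= n)%N & del <= N (F n).
Proof.
have /andP[a0 a1] := ha.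
exists (M * M)%N; first by case: M => // M; rewrite leq_pmulr.
have sM : square (M * M) by apply/asboolP; exists M.
rewrite /N /del ler_wsqrtr // -lee_fin fineK //.
apply: le_trans (sq_ge (orbit_fun_coefs ha _)); rewrite lee_fin ler_wpM2l ?(ltW k1_gt0)
  //.
rewrite lerXn2r ?nnegrE ?normc_ge0 //; last exact: orbit_coef0_ge.
by rewrite divr_ge0 ?subr_ge0 ?mulr_ge0 ?addr_ge0 // ltW.
Qed.

Lemma li_yorke_criterion : li_yorke_chaotic X N T.
Proof.
split; first exact: comp_op_bounded.
pose S : set (disk R -> C) := [set t%:C *: F 0%N | t in [set: R]].
(* Uncountability of [S] rests on this injectivity, which follows from the existence of an iterate
   of positive norm. *)
have inj (s t : R) : s%:C *: F 0%N = t%:C *: F 0%N -> s = t.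
  move=> st; have [n _ hn] := N_large 0.
  have := N_diff n s t; rewrite st subrr.
  have -> : (0 : disk R -> C) = (0 : R)%:C *: F n by rewrite scale0r.
  have NF0 : N ((0 : R)%:C *: F n) = 0.
    by rewrite /N sq_scale // expr0n mul0e sqrtr0.
  rewrite NF0 => /esym/eqP; rewrite mulf_eq0 normr_eq0 subr_eq0 => /orP[/eqP //|/eqP h].
  by have := del_gt0; rewrite ltNge -h hn.
exists S; split.
- move=> _ [t _ <-]; split; first exact: analytic_scale.
  by rewrite sq_scale // -(fineK (sqF_fin _)) -EFinM ltry.
- move=> cS; apply: uncountable_real.
  rewrite -(eq_countable (inj_card_eq (f := fun t : R => t%:C *: F 0%N) _)) //.
  by move=> s t _ _; exact: inj.
- move=> _ _ [s _ <-] [t _ <-] st /=.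
  have st0 : 0 < `|s - t|.
    by rewrite normr_gt0 subr_eq0; apply/eqP => h; apply: st; rewrite h.
  have dE : (fun n => (N (iter n T (s%:C *: F 0%N) - iter n T (t%:C *: F 0%N)))%:E) =
      (fun n => (`|s - t| * N (F n))%:E) by apply/funext => n; rewrite N_diff.
  rewrite dE; split.
    apply: limn_einf_eq0 => [n|e e0 M]; first by rewrite mulr_ge0 ?sqrtr_ge0.
    have [n Mn hn] := N_small (divr_gt0 e0 st0) M; exists n => //.
    by rewrite mulrC -ler_pdivlMr.
  apply: (@limn_esup_gt0 _ (`|s - t| * del)) => [|M]; first exact: mulr_gt0.
  by have [n Mn hn] := N_large M; exists n => //; rewrite ler_pM2l.
Qed.

End Criterion.

(** * The criterion applied to the Hardy and Bergman norms *)

Section Instances.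
Variable R : realType.
Local Notation C := (Cplx R).
Local Notation T := (measurableTypeR R).
Local Notation mu := (@lebesgue_measure R).
Implicit Types (f : disk R -> C) (c : nat -> C).
Variable a : R.
Hypothesis ha : 0 < a < 1.

Lemma has_coefs_scale f c (x : C) : has_coefs f c -> has_coefs (x *: f) (fun n => x * c
  n).
Proof.
by move=> hc z; apply: has_csum_eq (has_csumZ x (hc z)) => n; rewrite mulrA.
Qed.

Lemma hmean_scale c (t r : R) : hmean (fun n => t%:C * c n) r = ((t ^+ 2)%:E * hmean c
  r)%E.
Proof.
rewrite /hmean -nneseriesZl; last by move=> n _; rewrite lee_fin sqr_ge0.
apply: eq_eseriesr => n _; rewrite -EFinM modM mod_real -mulrA exprMn real_normK
  ?num_real //.
Qed.

Lemma hmean_coef0 c r : ((normc (c 0%N) ^+ 2)%:E <= hmean c r)%E.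
Proof.
by apply: le_trans (hmean_partial c r 1); rewrite big_ord_recl big_ord0 /= mulr1 addr0.
Qed.

Lemma contract_itv r : 0 <= r < 1 -> 0 <= contract a r < 1.
Proof.
have /andP[a0 a1] := ha; move=> /andP[r0 r1].
by rewrite /contract; apply/andP; split; nra.
Qed.

Lemma hardy_li_yorke : li_yorke_chaotic (@hardy_space R) (@hardy_norm R) (comp_op
  (affine_map ha)).
Proof.
have /andP[a0 a1] := ha.
have K0 : 0 <= 2 / a by rewrite divr_ge0 // ltW.
apply: (@li_yorke_criterion R a ha (@hardy_sqnorm R) 1 1 (2 / a)) => //.
- move=> f c hf; rewrite mul1r (hardy_sqnorm_hmean hf).
  apply: le_trans (hmean_coef0 c 2^-1) _; apply: ereal_sup_ubound.
  by exists 2^-1 => //; rewrite /= in_itv /=; apply/andP; split; lra.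
- move=> f c hf; rewrite mul1e (hardy_sqnorm_hmean hf).
  apply: ge_ereal_sup => _ [r /= + <-]; rewrite in_itv /= => /andP[r0 r1].
  by apply: hmean_mono; rewrite !ltW.
- move=> f t /analytic_has_coefs[c hf].
  rewrite (hardy_sqnorm_hmean hf) (hardy_sqnorm_hmean (has_coefs_scale t%:C hf)).
  rewrite -ereal_supZl ?sqr_ge0 //.
    congr ereal_sup; apply/seteqP; split => [_ [r r01 <-]|_ [_ [r r01 <-] <-]].
      by exists (hmean c r); [exists r|rewrite hmean_scale].
    by exists r => //; rewrite hmean_scale.
  apply/set0P; exists (hmean c 2^-1); exists 2^-1 => //=.
  by rewrite in_itv /=; apply/andP; split; lra.
- move=> f /analytic_has_coefs[c hf].
  have [d hd hle] := has_coefs_comp ha hf.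
  rewrite (hardy_sqnorm_hmean hf) (hardy_sqnorm_hmean hd).
  apply: ge_ereal_sup => _ [r /= + <-]; rewrite in_itv /= => /andP[r0 r1].
  apply: le_trans (hle r _) _; first by rewrite !ltW.
  (* The contracted radius is still in the open unit interval, so its mean is among those over which
     the supremum runs. *)
  rewrite lee_wpmul2l ?lee_fin //; apply: ereal_sup_ubound; exists (contract a r) => //.
  have /andP[h1 h2] : 0 <= contract a r < 1 by apply: contract_itv; rewrite ltW.
  rewrite /= in_itv /= h2 andbT /contract; nra.
Qed.

Lemma bergman_li_yorke b : -1 < b ->
  li_yorke_chaotic (bergman_space b) (bergman_norm b) (comp_op (affine_map ha)).
Proof.
move=> b1; have /andP[a0 a1] := ha.
have [m m0 hm] := radial_mass b1.
have w0 x : (0 <= (radial_weight b x)%:E)%E by rewrite lee_fin radial_weight_ge0.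
have mw : measurable_fun (setT : set T) (fun x => (radial_weight b x)%:E).
  by apply/measurable_EFinP; exact: measurable_radial_weight.
have mabs : measurable_fun (setT : set T) (fun x : T => `|x| : T) by exact:
  normr_measurable.
have mh c : measurable_fun (setT : set T) (fun x : T => hmean c `|x|).
  exact: measurableT_comp (measurable_hmean c) mabs.
have mwh c : measurable_fun (setT : set T) (fun x : T => (radial_weight b x)%:E * hmean
  c `|x|%R)%E.
  exact: emeasurable_funM.
have mcontract : measurable_fun (setT : set T) (fun x : T => contract a `|x| : T).
  apply: measurable_funB; first exact: measurable_cst.
  apply: measurable_funM; first exact: measurable_cst.
  by apply: measurable_funB; first exact: measurable_cst.
have int_cst (k : \bar R) : (0 <= k)%E -> (\int[mu]_x ((radial_weight b x)%:E * k) =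
  m%:E * k)%E.
  move=> k0; rewrite -hm.
  exact: (@ge0_integralZr _ _ _ mu setT measurableT _ mw k (fun x _ => w0 x) k0).
have K0 : 0 <= 2 / a by rewrite divr_ge0 // ltW.
have C0 : 0 <= radial_const a b.
  by apply: mulr_ge0 => //; apply: mulr_ge0 => //; rewrite le_max ler01.
have out (x : R) (h : R -> \bar R) : 1 <= `|x| -> ((radial_weight b x)%:E * h x = 0)%E.
  by move=> x1; rewrite /radial_weight ltNge x1 mul0e.
(* The mass [m] serves for both bounds because, where the weight is nonzero, [hmean c] lies between
   [normc (c 0%N) ^+ 2] and [hmean c 1]. The last constant multiplies Schur's [2 / a] by that of the
   change of variable. *)
apply: (@li_yorke_criterion R a ha (@bergman_sqnorm R b) m m (2 / a * radial_const a b))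
  => //.
- exact: ltW.
- exact: mulr_ge0.
- move=> f c hf; rewrite (bergman_sqnorm_radial b1 hf) EFinM -int_cst ?lee_fin ?sqr_ge0
  //.
  apply: ge0_le_integral => //.
  + by move=> x _; rewrite mule_ge0 // lee_fin sqr_ge0.
  + by apply: emeasurable_funM => //; exact: measurable_cst.
  + by move=> x _; rewrite lee_wpmul2l // hmean_coef0.
- move=> f c hf; rewrite (bergman_sqnorm_radial b1 hf) -int_cst ?hmean_ge0 //.
  apply: ge0_le_integral => //.
  + by move=> x _; rewrite mule_ge0 // hmean_ge0.
  + by apply: emeasurable_funM => //; exact: measurable_cst.
  move=> x _; case: (leP 1 `|x|) => x1; last by rewrite lee_wpmul2l // hmean_mono //
    normr_ge0 ltW.
  by rewrite (out x (fun x => hmean c `|x|)) // (out x (fun=> hmean c 1)).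
- move=> f t /analytic_has_coefs[c hf].
  rewrite (bergman_sqnorm_radial b1 hf) (bergman_sqnorm_radial b1 (has_coefs_scale t%:C
    hf)).
  have t0 : (0 <= (t ^+ 2)%:E)%E by rewrite lee_fin sqr_ge0.
  have wh0 (x : T) : (0 <= (radial_weight b x)%:E * hmean c `|x|%R)%E by rewrite
    mule_ge0 // hmean_ge0.
  have <- := @ge0_integralZl _ _ _ mu setT measurableT _ (mwh c) (t ^+ 2)%:E (fun x _ =>
    wh0 x) t0.
  by apply: eq_integral => x _; rewrite hmean_scale muleCA.
- move=> f /analytic_has_coefs[c hf].
  have [d hd hle] := has_coefs_comp ha hf.
  rewrite (bergman_sqnorm_radial b1 hf) (bergman_sqnorm_radial b1 hd).
  apply: (@le_trans _ _ ((2 / a)%:E * \int[mu]_x ((radial_weight b x)%:E * hmean c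
    (contract a `|x|%R)))%E); last first.
    rewrite [(2 / a * radial_const a b)%:E]EFinM -muleA lee_wpmul2l ?lee_fin //.
    by apply: radial_compare => // [|x]; [exact: measurable_hmean|exact: hmean_ge0].
  have mwc : measurable_fun (setT : set T) (fun x : T => (radial_weight b x)%:E * hmean
    c (contract a `|x|%R))%E.
    by apply: emeasurable_funM => //; exact: measurableT_comp (measurable_hmean c)
      mcontract.
  have wc0 (x : T) : (0 <= (radial_weight b x)%:E * hmean c (contract a `|x|%R))%E by
    rewrite mule_ge0 // hmean_ge0.
  have K0E : (0 <= (2 / a)%:E)%E by rewrite lee_fin.
  have <- := @ge0_integralZl _ _ _ mu setT measurableT _ mwc (2 / a)%:E (fun x _ => wc0
    x) K0E.
  apply: ge0_le_integral => //.
  + by move=> x _; rewrite mule_ge0 // hmean_ge0.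
  + by apply: emeasurable_funM => //; exact: measurable_cst.
  move=> x _; case: (leP 1 `|x|) => x1.
    by rewrite (out x (fun x => hmean d `|x|)) // mule_ge0.
  by rewrite muleCA lee_wpmul2l // hle // normr_ge0 ltW.
Qed.

End Instances.

Theorem proposition4 (R : realType) (a : R) (ha : 0 < a < 1) :
  li_yorke_chaotic (@hardy_space R) (@hardy_norm R) (comp_op (affine_map ha)) /\
  (forall b : R, -1 < b ->
     li_yorke_chaotic (bergman_space b) (bergman_norm b)
       (comp_op (affine_map ha))).
Proof.
split; first exact: hardy_li_yorke.
by move=> b; exact: bergman_li_yorke.
Qed.
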